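(* Let $M,N$ be smooth surface pieces in $\mathbb{R}^3$ and let $S_0$ be a sphere of radius $r_0$ tangent to $M$ at $\mathbf{p}_0$ and to $N$ at a distinct point $\mathbf{q}_0$, neither point being an umbilic. Let $(s,t)$ and $(u,v)$ be the local parameters on $M$ near $\mathbf{p}_0$ and on $N$ near $\mathbf{q}_0$, and let $G(s,t,u,v,r)=\mathbf{p}+r\mathbf{m}-\mathbf{q}-r\mathbf{n}\in\mathbb{R}^3$. Suppose that the contact of $S_0$ with $N$ at $\mathbf{q}_0$ is of type $A_1$, which is the same as saying that $r_0\neq 1/\lambda_1$ and $r_0\neq 1/\lambda_2$, where $\lambda_1,\lambda_2$ are the principal curvatures of $N$ at $\mathbf{q}_0$. Then, locally near $(s,t,u,v,r)=(0,0,0,0,r_0)$, $u,v,r$ are smooth functions of $s$ and $t$ on the set $G=0$; in particular the (local) pre-symmetry set $$\{(s,t,u,v): G(s,t,u,v,r)=0\ \text{for some } r\}$$ is the graph of a smooth function $g:(s,t)\mapsto(u,v)$.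
   Context: Notation. $(s,t)$ are local parameters on $M$ near $\mathbf{p}_0$ with $s=t=0$ at $\mathbf{p}_0$, such that the coordinate curves $s=\text{const}$ and $t=\text{const}$ are lines of curvature (principal curves) and the curves $s=0$, $t=0$ are unit speed. Similarly $(u,v)$ are such parameters on $N$ near $\mathbf{q}_0$, with $u=v=0$ at $\mathbf{q}_0$. General points of $M$ and $N$ are $\mathbf{p}=\mathbf{p}(s,t)$ and $\mathbf{q}=\mathbf{q}(u,v)$. $\mathbf{m}$ is the unit normal to $M$ at $\mathbf{p}$ and $\mathbf{n}$ is the unit normal to $N$ at $\mathbf{q}$, oriented so that at $\mathbf{p}_0$, respectively $\mathbf{q}_0$, the normal points towards the centre of $S_0$ (so $\mathbf{p}_0+r_0\mathbf{m}=\mathbf{q}_0+r_0\mathbf{n}$ is the centre). Principal curvatures are taken with respect to these normals, with sign such that the derivative of $\mathbf{n}$ in a principal direction $\mathbf{f}_i$ is $-\lambda_i\mathbf{f}_i$. The sphere with centre $c$ and radius $r_0$ has contact of type $A_k$ with a surface at a point $x_0$ if the function $x\mapsto|x-c|^2-r_0^2$ restricted to the surface has an $A_k$ singularity at $x_0$ (i.e. in suitable local coordinates it is $\pm x^{k+1}\pm y^2$), with value $0$. The local pre-symmetry set of $M,N$ is the set of $(s,t,u,v)$ near $0\in\mathbb{R}^4$ such that there is a sphere, close to $S_0$, tangent to $M$ at the point with parameters $(s,t)$ and to $N$ at the point with parameters $(u,v)$; that is, $G(s,t,u,v,r)=0$ for some $r$ near $r_0$. *)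

(* Defs.v *)
(* MathComp / MathComp-Analysis *)
From HB Require Import structures.
From mathcomp Require Import all_boot all_order all_algebra.
From mathcomp Require Import all_classical all_reals all_analysis.

Set Implicit Arguments.
Unset Strict Implicit.
Unset Printing Implicit Defensive.

Import Order.TTheory GRing.Theory Num.Theory.
Import numFieldNormedType.Exports.

Local Open Scope classical_set_scope.
Local Open Scope ring_scope.

(* C^oo on the open set U.  Since differentiability of an iterated derivative
   gives its continuity and the existence of the next ones, this says that all
   iterated directional derivatives exist and are continuous on U. *)
Definition smooth (R : realType) (V W : normedModType R) (U : set V)
    (f : V -> W) : Prop :=
  forall (vs : seq V) (x : V), U x ->
    differentiable (foldr (fun v (h : V -> W) => 'D_v h) f vs) x.

(* The library norm on row vectors is the sup norm; Euclidean lengths go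
   through dot. *)
Definition dot (R : realType) (n : nat) (a b : 'rV[R]_n) : R :=
  (a *m b^T) 0 0.

Section Surface.
Variable R : realType.
Implicit Types (U : set 'rV[R]_2) (p m : 'rV[R]_2 -> 'rV[R]_3).
Implicit Types (x w : 'rV[R]_2) (c : 'rV[R]_3) (r l : R).

Definition par0 : 'rV[R]_2 := delta_mx 0 0.
Definition par1 : 'rV[R]_2 := delta_mx 0 1.

(* A surface piece is given by a regular parametrization p on an open
   neighbourhood U of 0, with a smooth unit normal field m. *)
Definition oriented_patch U p m : Prop :=
  [/\ open U, U 0, smooth U p, smooth U m &
      forall x, U x ->
        [/\ forall w, 'D_w p x = 0 -> w = 0,
            dot (m x) (m x) = 1 &
            forall w, dot (m x) ('D_w p x) = 0]].

(* A tangent vector is represented by its preimage w in the parameter plane: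
   the derivative of m in the direction f = 'D_w p x is 'D_w m x. *)
Definition principal_vector p m x w l : Prop :=
  w != 0 /\ 'D_w m x = - l *: 'D_w p x.

Definition principal_curvatures p m x : set R :=
  [set l | exists w, principal_vector p m x w l].

Definition umbilic p m x : Prop :=
  exists l, forall w, 'D_w m x = - l *: 'D_w p x.

(* The coordinate curves are lines of curvature; only the two curves through
   the origin are required to be unit speed. *)
Definition curvature_line_parameters U p m : Prop :=
  [/\ forall x, U x -> exists l, principal_vector p m x par0 l,
      forall x, U x -> exists l, principal_vector p m x par1 l,
      forall x, U x -> x 0 1 = 0 -> dot ('D_par0 p x) ('D_par0 p x) = 1 &
      forall x, U x -> x 0 0 = 0 -> dot ('D_par1 p x) ('D_par1 p x) = 1].

Definition tangent_sphere c r p x : Prop :=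
  dot (p x - c) (p x - c) = r ^+ 2 /\ forall w, dot (p x - c) ('D_w p x) = 0.

Definition points_towards c p m x : Prop := 0 < dot (m x) (c - p x).

(* phi, with inverse psi, is a local coordinate system centred at x0. *)
Definition local_coordinates (x0 : 'rV[R]_2) (A B : set 'rV[R]_2)
    (phi psi : 'rV[R]_2 -> 'rV[R]_2) : Prop :=
  [/\ open A, open B, A 0, phi 0 = x0 &
      [/\ smooth A phi, smooth B psi,
          forall a, A a -> B (phi a) /\ psi (phi a) = a &
          forall b, B b -> A (psi b) /\ phi (psi b) = b]].

Definition Ak_singularity (k : nat) (f : 'rV[R]_2 -> R) (x0 : 'rV[R]_2) :
    Prop :=
  exists (A B : set 'rV[R]_2) (phi psi : 'rV[R]_2 -> 'rV[R]_2)
    (e1 e2 : bool),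
    local_coordinates x0 A B phi psi /\
    forall a, A a ->
      f (phi a) =
        f x0 + (-1) ^+ e1 * a 0 0 ^+ k.+1 + (-1) ^+ e2 * a 0 1 ^+ 2.

(* Contact is expressed in the parameter plane: since p is a local chart, local
   coordinates on the surface are local coordinates there. *)
Definition sphere_contact (k : nat) c r p x : Prop :=
  let f y := dot (p y - c) (p y - c) - r ^+ 2 in
  f x = 0 /\ Ak_singularity k f x.

Definition Gmap p m (q n : 'rV[R]_2 -> 'rV[R]_3) (x y : 'rV[R]_2) r :
    'rV[R]_3 :=
  p x + r *: m x - q y - r *: n y.

(* J is the range allowed for the radius. *)
Definition presymmetry_set (J : set R) p m (q n : 'rV[R]_2 -> 'rV[R]_3) :
    set ('rV[R]_2 * 'rV[R]_2) :=
  [set z | exists2 r, J r & Gmap p m q n z.1 z.2 r = 0].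

End Surface.

Arguments par0 {R}.
Arguments par1 {R}.

(* Main.v *)
Require Import Defs.
From HB Require Import structures.
From mathcomp Require Import all_boot all_order all_algebra.
From mathcomp Require Import all_classical all_reals all_analysis.
From mathcomp Require Import ring lra.
Import Order.TTheory GRing.Theory Num.Theory.
Import numFieldNormedType.Exports.
Local Open Scope classical_set_scope.
Local Open Scope ring_scope.

(** Why the theorem holds.

    Contact.  Put f y = |q y - c|^2 - r0^2.  Tangency makes 0 a critical point
    of f, and there q - c = - r0 n, so the Hessian of f at 0 is
    2 (D_v q + r0 D_v n) . D_w q  ([dist2_hessian]).  The coordinate lines are
    lines of curvature with distinct curvatures k0 and k1, because 0 is not
    umbilic; symmetry of the Hessian then makes the two directions orthogonal,
    and the Hessian is diagonal with entries 2 (1 - r0 k_i)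
    ([dist2_hessian_principal]).  A function has an A1 singularity exactly
    when its Hessian at the critical point is nondegenerate: one direction is
    a computation in the coordinates of the normal form ([A1_hessian_inj]),
    the other is the Morse lemma in the plane ([morse_plane]).  Hence the
    contact is A1 if and only if 1 - r0 k_i is nonzero for both i
    ([contact_A1_iff]).

    Graph.  The derivative of G with respect to (u, v, r) at the base point
    has columns - (1 - r0 k_i) f_i and m - n.  The f_i span the plane
    orthogonal to n, and (m - n) . n is nonzero since m and n are distinct
    unit vectors: equal normals and a common centre would give p 0 = q 0.  So
    the derivative is invertible and the implicit function theorem gives
    u, v, r as smooth functions of s, t for r near r0.  Moreover G = 0 reads
    q - p = r (m - n), which determines r continuously from the two points;
    on a small enough neighbourhood every solution therefore has its radius
    near r0, and the graph accounts for all of them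
    ([tangent_spheres_graph]).

    Analysis.  The inverse function theorem ([inverse_function]) comes from a
    contraction estimate; its inverse is smooth because its derivative is the
    inverse Jacobian matrix composed with the inverse map itself, so each
    order of differentiability yields the next.  The Morse lemma rests on
    Hadamard's lemma ([hadamard]), for which the integral of
    t^j g (t x) over the unit interval is shown to depend smoothly on x. *)

Set Implicit Arguments.
Unset Strict Implicit.
Unset Printing Implicit Defensive.

(** * First-order calculus in normed modules *)

Section FirstOrder.
Context {R : realType}.
Implicit Types V W : normedModType R.

(** An explicit remainder bound is easier to produce than a Landau equality:
    derivatives of products, of inverse maps and of integrals are all obtained
    through this criterion. *)
Lemma differentiable_of_estimate V W (f : V -> W) (L : {linear V -> W}) (x : V) :
  continuous L ->
  (forall e, 0 < e -> \forall h \near 0, `|f (h + x) - f x - L h| <= e * `|h|) ->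
  differentiable f x /\ forall v, 'D_v f x = L v.
Proof.
move=> Lc fe.
have fL : f \o shift x = cst (f x) + L +o_ 0 id.
  apply/eqaddoP => e e0; near=> h.
  rewrite /= [X in `|X|](_ : _ = f (h + x) - f x - L h).
    by near: h; exact: fe.
  by rewrite -[LHS]/(f (h + x) - (f x + L h)) opprD addrA.
have dL := diff_unique Lc fL.
have df : differentiable f x by apply/diff_locallyP; rewrite dL.
by split=> // v; rewrite deriveE // dL.
Unshelve. all: by end_near. Qed.

Lemma differentiable_estimate V W (f : V -> W) (x : V) : differentiable f x ->
  forall e, 0 < e ->
  \forall h \near 0, `|f (h + x) - f x - 'D_h f x| <= e * `|h|.
Proof.
move=> df e e0; have /eqaddoP/(_ e e0) := diff_locally df.
apply: filterS => h /=; rewrite deriveE //.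
by rewrite -[X in `|X| <= _]/(f (h + x) - (f x + _)) opprD addrA.
Qed.

Lemma near_translate V (P : V -> Prop) (x : V) :
  (\near x, P x) -> \forall h \near (0 : V), P (h + x).
Proof. by rewrite (near_shift 0 x) /= subr0. Qed.

Lemma near_eq_differentiable V W (f g : V -> W) (x : V) :
  (\near x, f x = g x) -> differentiable f x -> differentiable g x.
Proof.
move=> fg df.
have fgx : f x = g x := nbhs_singleton fg.
apply: (proj1 (@differentiable_of_estimate _ _ g ('d f x) x _ _)).
  exact: diff_continuous.
move=> e e0; have := differentiable_estimate df e0.
have : \forall h \near (0 : V), f (h + x) = g (h + x).
  exact: near_translate fg.
by apply: filterS2 => h <-; rewrite fgx deriveE.
Qed.

Lemma derive_comp_diff V W W' (f : V -> W) (g : W -> W') (x v : V) :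
  differentiable f x -> differentiable g (f x) ->
  'D_v (g \o f) x = 'D_('D_v f x) g (f x).
Proof.
move=> df dg; rewrite !deriveE//; last exact: differentiable_comp.
by rewrite diff_comp.
Qed.

Lemma derive_linear V W (L : {linear V -> W}) (x v : V) :
  continuous L -> 'D_v L x = L v.
Proof.
by move=> Lc; rewrite deriveE ?diff_lin//; exact: linear_differentiable.
Qed.

Lemma derive_linear_dir V W (f : V -> W) (x : V) : differentiable f x ->
  linear (fun v => 'D_v f x).
Proof. by move=> df a u v; rewrite !deriveE // linearP. Qed.

Lemma deriveZv V W (f : V -> W) (x v : V) (a : R) : differentiable f x ->
  'D_(a *: v) f x = a *: 'D_v f x.
Proof. by move=> df; rewrite !deriveE // linearZ. Qed.

Lemma derive_coord W n (g : 'rV[R]_n -> W) (y w : 'rV[R]_n) :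
  differentiable g y ->
  'D_w g y = \sum_i w 0 i *: 'D_(delta_mx 0 i) g y.
Proof.
move=> dg; rewrite {1}(row_sum_delta w) deriveE // linear_sum.
by apply: eq_bigr => i _; rewrite linearZ /= deriveE.
Qed.

(** The remainder of a product splits as r_a f + a r_f + a' (f - f(x)), and
    each of the three terms is o(h). *)
Lemma differentiable_scale V W (a : V -> R) (f : V -> W) (x : V) :
  differentiable a x -> differentiable f x ->
  differentiable (fun y => a y *: f y) x /\
  forall v, 'D_v (fun y => a y *: f y) x = 'D_v a x *: f x + a x *: 'D_v f x.
Proof.
move=> da df.
have Lin : linear (fun v => 'D_v a x *: f x + a x *: 'D_v f x).
  move=> k u v; rewrite !derive_linear_dir // scalerDl !scalerDr !scalerA.
  by rewrite [a x * k]mulrC !addrA; congr (_ + _); rewrite addrAC.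
pose Lm := GRing.isLinear.Build R V W _ _ Lin.
pose L : {linear V -> W} := HB.pack (fun v => 'D_v a x *: f x + a x *: 'D_v f x) Lm.
have dac : continuous (fun v => 'D_v a x).
  have -> : (fun v => 'D_v a x) = 'd a x by apply/funext => v; rewrite deriveE.
  exact: diff_continuous.
have dfc : continuous (fun v => 'D_v f x).
  have -> : (fun v => 'D_v f x) = 'd f x by apply/funext => v; rewrite deriveE.
  exact: diff_continuous.
have Lc : continuous L.
  move=> y; apply: (@cvgD _ _ _ _ _ (fun v => 'D_v a x *: f x) (fun v => a x *: 'D_v f x)).
    by apply: cvgZr_tmp; exact: dac.
  by apply: cvgZl_tmp; exact: dfc.
apply: (differentiable_of_estimate Lc) => /=.
move=> e e0.
have [k k0 ak] := linear_lipschitz (diff_continuous da).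
pose M := `|f x| + 1.
have M0 : 0 < M by rewrite ltr_wpDl.
have a0 : 0 < `|a x| + 1 by rewrite ltr_wpDl.
have fc : \forall h \near (0 : V), `|f (h + x) - f x| <= Num.min 1 (e / 3 / k).
  have /= := differentiable_continuous df.
  move=> /cvgr_dist_le /(_ (Num.min 1 (e / 3 / k))).
  rewrite lt_min ltr01 !divr_gt0// => /(_ isT) /near_translate.
  by apply: filterS => h; rewrite distrC.
have e1 : 0 < e / 3 / M by rewrite !divr_gt0.
have e2 : 0 < e / 3 / (`|a x| + 1) by rewrite !divr_gt0.
near=> h.
have h1 : `|a (h + x) - a x - 'D_h a x| <= e / 3 / M * `|h|.
  by near: h; exact: differentiable_estimate.
have h2 : `|f (h + x) - f x - 'D_h f x| <= e / 3 / (`|a x| + 1) * `|h|.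
  by near: h; exact: differentiable_estimate.
have h3 : `|f (h + x) - f x| <= Num.min 1 (e / 3 / k) by near: h.
have -> : a (h + x) *: f (h + x) - a x *: f x - L h =
  (a (h + x) - a x - 'D_h a x) *: f (h + x) +
  (a x *: (f (h + x) - f x - 'D_h f x) + 'D_h a x *: (f (h + x) - f x)).
  rewrite /L /= !scalerBl !scalerBr.
  set A := a (h + x) *: _; set B := a x *: f (h + x).
  rewrite -[A - B - _]addrA -opprD [X in _ = _ + X](AC (3*2) ((1*4)*(2*3*5))).
  by rewrite subrKA [X in _ - X = _]addrC opprD !addrA.
have h1' : `|(a (h + x) - a x - 'D_h a x) *: f (h + x)| <= e / 3 * `|h|.
  rewrite normrZ (le_trans (ler_wpM2r _ h1)) //.
  have : `|f (h + x)| <= M.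
    rewrite -[f (h + x)](subrK (f x)) (le_trans (ler_normD _ _)) // addrC lerD2l.
    by move: h3; rewrite le_min => /andP[].
  move=> fM; apply: le_trans (ler_wpM2l _ fM) _.
    by rewrite mulr_ge0 // (ltW e1).
  by rewrite mulrAC divfK // gt_eqF.
have h2' : `|a x *: (f (h + x) - f x - 'D_h f x)| <= e / 3 * `|h|.
  rewrite normrZ (le_trans (ler_wpM2l _ h2)) // mulrA ler_wpM2r //.
  rewrite mulrA ler_pdivrMr // mulrC ler_wpM2l ?lerDl //.
  by rewrite divr_ge0 // ltW.
have h3' : `|'D_h a x *: (f (h + x) - f x)| <= e / 3 * `|h|.
  have hk : `|'D_h a x| <= k * `|h| by rewrite deriveE // ak.
  have h3k : `|f (h + x) - f x| <= e / 3 / k.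
    by move: h3; rewrite le_min => /andP[].
  rewrite normrZ (le_trans (ler_pM _ _ hk h3k)) //.
  by rewrite mulrC mulrA divfK // gt_eqF.
rewrite (le_trans (ler_normD _ _)) //.
rewrite (le_trans (lerD h1' (ler_normD _ _))) //.
rewrite (le_trans (lerD (lexx _) (lerD h2' h3'))) //.
lra.
Unshelve. all: by end_near. Qed.

End FirstOrder.

(** * Closure properties of smooth maps *)

Section SmoothCalculus.
Context {R : realType}.
Implicit Types V W : normedModType R.

(** Truncation of smoothness at order k. Being recursive in k, it turns every
    closure property into an induction in which the derivative of a compound
    map is built from maps of lower order. *)
Fixpoint ndiff V W (k : nat) (U : set V) (f : V -> W) : Prop :=
  (forall x, U x -> differentiable f x) /\
  (if k is k'.+1 then forall v, ndiff k' U ('D_v f) else True).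

Lemma smoothP V W (U : set V) (f : V -> W) :
  smooth U f <-> forall k, ndiff k U f.
Proof.
split=> [sf k|nf vs x Ux].
  elim: k f sf => [|k IH] f sf.
    by split=> // x Ux; exact: (sf [::] x).
  split=> [x Ux|v]; first exact: (sf [::] x).
  by apply: IH => vs x Ux; have := sf (rcons vs v) x Ux; rewrite foldr_rcons.
elim/last_ind: vs f nf => [|vs v IH] f nf; first exact: (proj1 (nf 0%N)).
by rewrite foldr_rcons; apply: IH => k; exact: (proj2 (nf k.+1)).
Qed.

Lemma ndiff_differentiable V W k (U : set V) (f : V -> W) (x : V) :
  ndiff k U f -> U x -> differentiable f x.
Proof. by case: k => [|k] [df _]; exact: df. Qed.

Lemma ndiff_derive V W k (U : set V) (f : V -> W) (v : V) :
  ndiff k.+1 U f -> ndiff k U ('D_v f).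
Proof. by case=> _ nf; exact: nf. Qed.

Lemma ndiff_weaken V W k (U : set V) (f : V -> W) : ndiff k.+1 U f -> ndiff k U f.
Proof.
elim: k f => [|k IH] f [df df']; first by split.
by split=> // v; apply: IH; exact: df'.
Qed.

Lemma ndiff_subset V W k (U U' : set V) (f : V -> W) :
  U' `<=` U -> ndiff k U f -> ndiff k U' f.
Proof.
move=> sU; elim: k f => [|k IH] f [df df'].
  by split=> // x /sU; exact: df.
by split=> [x /sU|v]; [exact: df|apply: IH; exact: df'].
Qed.

Lemma ndiff_eq V W k (U : set V) (f g : V -> W) : open U ->
  (forall x, U x -> f x = g x) -> ndiff k U f -> ndiff k U g.
Proof.
move=> Uo; elim: k f g => [|k IH] f g fg nf.
  split=> // x Ux; apply: near_eq_differentiable (ndiff_differentiable nf Ux).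
  by near=> y; apply: fg; near: y; exact: open_nbhs_nbhs.
split=> [x Ux|v].
  apply: near_eq_differentiable (ndiff_differentiable nf Ux).
  by near=> y; apply: fg; near: y; exact: open_nbhs_nbhs.
apply: (IH ('D_v f)); last exact: ndiff_derive.
move=> x Ux; apply: near_eq_derive.
by near=> y; apply: fg; near: y; exact: open_nbhs_nbhs.
Unshelve. all: by end_near. Qed.

(** The derivatives need only be identified on U, where a closed formula for
    them is available; outside U they carry no information. *)
Lemma ndiffS V W k (U : set V) (f : V -> W) (df : V -> V -> W) : open U ->
  (forall x, U x -> differentiable f x) ->
  (forall v x, U x -> 'D_v f x = df v x) ->
  (forall v, ndiff k U (df v)) -> ndiff k.+1 U f.
Proof.
move=> Uo fd fE dfn; split=> // v; apply: ndiff_eq (dfn v) => // x Ux.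
by rewrite fE.
Qed.

Lemma ndiff_cst V W k (U : set V) (w : W) : ndiff k U (cst w).
Proof.
elim: k w => [|k IH] w; split=> // v.
suff -> : 'D_v (cst w) = cst 0 by exact: IH.
by apply/funext => x; rewrite derive_cst.
Qed.

Lemma ndiff_linear V W k (U : set V) (L : {linear V -> W}) :
  continuous L -> ndiff k U L.
Proof.
move=> Lc; case: k => [|k]; split=> //.
- by move=> x _; exact: linear_differentiable.
- by move=> x _; exact: linear_differentiable.
- move=> v; suff -> : 'D_v L = cst (L v) by exact: ndiff_cst.
  by apply/funext => x; rewrite derive_linear.
Qed.

Lemma ndiffD V W k (U : set V) (f g : V -> W) : open U ->
  ndiff k U f -> ndiff k U g -> ndiff k U (fun x => f x + g x).
Proof.
move=> Uo; elim: k f g => [|k IH] f g nf ng.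
  by split=> // x Ux; apply: differentiableD;
    [exact: ndiff_differentiable nf Ux|exact: ndiff_differentiable ng Ux].
apply: (@ndiffS _ _ _ _ _ (fun v x => 'D_v f x + 'D_v g x)) => //.
- by move=> x Ux; apply: differentiableD;
    [exact: ndiff_differentiable nf Ux|exact: ndiff_differentiable ng Ux].
- move=> v x Ux; rewrite (@deriveD _ _ _ f g) //; apply: diff_derivable.
    exact: ndiff_differentiable nf Ux.
  exact: ndiff_differentiable ng Ux.
- by move=> v; apply: IH; exact: ndiff_derive.
Qed.

Lemma ndiff_sum V W k (U : set V) I (s : seq I) (P : pred I) (f : I -> V -> W) :
  open U -> (forall i, P i -> ndiff k U (f i)) ->
  ndiff k U (fun x => \sum_(i <- s | P i) f i x).
Proof.
move=> Uo nf; elim: s => [|i s IH].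
  by apply: ndiff_eq (@ndiff_cst _ _ _ _ 0) => // x _; rewrite big_nil.
case Pi : (P i).
  apply: (@ndiff_eq _ _ _ _ (fun x => f i x + \sum_(i <- s | P i) f i x)) => //.
    by move=> x _; rewrite big_cons Pi.
  by apply: ndiffD => //; exact: nf.
by apply: ndiff_eq IH => // x _; rewrite big_cons Pi.
Qed.

Lemma ndiffZ V W k (U : set V) (a : V -> R) (f : V -> W) : open U ->
  ndiff k U a -> ndiff k U f -> ndiff k U (fun x => a x *: f x).
Proof.
move=> Uo; elim: k a f => [|k IH] a f na nf.
  by split=> // x Ux; have [] :=
    differentiable_scale (ndiff_differentiable na Ux) (ndiff_differentiable nf Ux).
apply: (@ndiffS _ _ _ _ _ (fun v x => 'D_v a x *: f x + a x *: 'D_v f x)) => //.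
- by move=> x Ux; have [] :=
    differentiable_scale (ndiff_differentiable na Ux) (ndiff_differentiable nf Ux).
- by move=> v x Ux; have [_] :=
    differentiable_scale (ndiff_differentiable na Ux) (ndiff_differentiable nf Ux); exact.
- move=> v; apply: ndiffD => //; apply: IH.
  + exact: ndiff_derive.
  + exact: ndiff_weaken.
  + exact: ndiff_weaken.
  + exact: ndiff_derive.
Qed.

Lemma ndiffM V k (U : set V) (a b : V -> R) : open U ->
  ndiff k U a -> ndiff k U b -> ndiff k U (fun x => a x * b x).
Proof. exact: ndiffZ. Qed.

Lemma ndiff_prod V k (U : set V) I (s : seq I) (P : pred I) (f : I -> V -> R) :
  open U -> (forall i, P i -> ndiff k U (f i)) ->
  ndiff k U (fun x => \prod_(i <- s | P i) f i x).
Proof.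
move=> Uo nf; elim: s => [|i s IH].
  by apply: ndiff_eq (@ndiff_cst _ R _ _ 1) => // x _; rewrite big_nil.
case Pi : (P i).
  apply: (@ndiff_eq _ _ _ _ (fun x => f i x * \prod_(i <- s | P i) f i x)) => //.
    by move=> x _; rewrite big_cons Pi.
  by apply: ndiffM => //; exact: nf.
by apply: ndiff_eq IH => // x _; rewrite big_cons Pi.
Qed.

Lemma ndiffV V k (U : set V) (a : V -> R) : open U ->
  (forall x, U x -> a x != 0) ->
  ndiff k U a -> ndiff k U (fun x => (a x)^-1).
Proof.
move=> Uo a0; elim: k a a0 => [|k IH] a a0 na.
  split=> // x Ux; apply: differentiableV; last exact: a0.
  exact: ndiff_differentiable na Ux.
apply: (@ndiffS _ _ _ _ _ (fun v x => -1 * ((a x)^-1 * (a x)^-1 * 'D_v a x))) => //.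
- move=> x Ux; apply: differentiableV; last exact: a0.
  exact: ndiff_differentiable na Ux.
- move=> v x Ux; rewrite deriveV ?a0 //; last first.
    by apply: diff_derivable; exact: ndiff_differentiable na Ux.
  by rewrite scaleNr mulN1r expr2 invfM.
- have IHa := IH a a0 (ndiff_weaken na).
  move=> v; apply: ndiffM => //; first exact: ndiff_cst.
  apply: ndiffM => //; last exact: ndiff_derive.
  exact: ndiffM.
Qed.

Lemma ndiff_sqrt V k (U : set V) (a : V -> R) : open U ->
  (forall x, U x -> 0 < a x) ->
  ndiff k U a -> ndiff k U (fun x => Num.sqrt (a x)).
Proof.
move=> Uo a0; elim: k a a0 => [|k IH] a a0 na.
  split=> // x Ux; apply: (@differentiable_comp _ _ _ _ a Num.sqrt).
    exact: ndiff_differentiable na Ux.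
  apply/derivable1_diffP.
  by have /(_ (a0 x Ux))[] := @is_derive1_sqrt _ (a x).
have ds x : U x -> differentiable Num.sqrt (a x).
  move=> Ux; apply/derivable1_diffP.
  by have /(_ (a0 x Ux))[] := @is_derive1_sqrt _ (a x).
apply: (@ndiffS _ _ _ _ _ (fun v x => 'D_v a x * (2 * Num.sqrt (a x))^-1)) => //.
- move=> x Ux; apply: (@differentiable_comp _ _ _ _ a Num.sqrt).
    exact: ndiff_differentiable na Ux.
  exact: ds.
- move=> v x Ux; rewrite (@derive_comp_diff _ _ _ _ a Num.sqrt); last first.
  + exact: ds.
  + exact: ndiff_differentiable na Ux.
  rewrite -['D_v a x]mulr1 (@deriveZv _ _ _ Num.sqrt (a x) 1); last exact: ds.
  by rewrite derive_sqrt ?mulr1// a0.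
- have IHa := IH a a0 (ndiff_weaken na).
  move=> v; apply: ndiffM => //; first exact: ndiff_derive.
  apply: ndiffV => //; last by apply: ndiffM => //; exact: ndiff_cst.
  by move=> x Ux; rewrite mulf_neq0// gt_eqF// sqrtr_gt0 a0.
Qed.

Lemma ndiff_linear_comp V W W' k (U : set V) (L : {linear W -> W'}) (f : V -> W) :
  open U -> continuous L -> ndiff k U f -> ndiff k U (L \o f).
Proof.
move=> Uo Lc; elim: k f => [|k IH] f nf.
  split=> // x Ux; apply: differentiable_comp.
    exact: ndiff_differentiable nf Ux.
  exact: linear_differentiable.
apply: (@ndiffS _ _ _ _ _ (fun v => L \o 'D_v f)) => //.
- move=> x Ux; apply: differentiable_comp.
    exact: ndiff_differentiable nf Ux.
  exact: linear_differentiable.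
- move=> v x Ux; rewrite derive_comp_diff.
  + by rewrite derive_linear.
  + exact: ndiff_differentiable nf Ux.
  + exact: linear_differentiable.
- by move=> v; apply: IH; exact: ndiff_derive.
Qed.

Lemma ndiff_coord V k m n (U : set V) (f : V -> 'M[R]_(m, n)) i j : open U ->
  ndiff k U f -> ndiff k U (fun x => f x i j).
Proof.
move=> Uo nf.
have Lin : linear (fun M : 'M[R]_(m, n) => M i j : R^o).
  by move=> a A B; rewrite !mxE.
pose L : {linear 'M[R]_(m, n) -> R^o} := HB.pack (fun M : 'M[R]_(m, n) => M i j)
  (GRing.isLinear.Build R _ R^o _ _ Lin).
have Lc : continuous L by move=> M; exact: coord_continuous.
exact: (ndiff_linear_comp Uo Lc nf).
Qed.

Lemma ndiff_coordP V k m n (U : set V) (f : V -> 'M[R]_(m, n)) : open U ->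
  (forall i j, ndiff k U (fun x => f x i j)) -> ndiff k U f.
Proof.
move=> Uo nf; apply: (@ndiff_eq _ _ _ _
  (fun x => \sum_i \sum_j f x i j *: (delta_mx i j : 'M[R]_(m, n)))) => //.
  by move=> x _; rewrite -matrix_sum_delta.
apply: ndiff_sum => // i _; apply: ndiff_sum => // j _.
by apply: ndiffZ => //; exact: ndiff_cst.
Qed.

(** In coordinates the chain rule reads D_v (g o f) = sum_i (D_v f)_i (D_i g o
    f), a sum of products of maps covered by the induction hypothesis. *)
Lemma ndiff_comp V W k n (U : set V) (O : set 'rV[R]_n)
    (f : V -> 'rV[R]_n) (g : 'rV[R]_n -> W) : open U ->
  (forall x, U x -> O (f x)) ->
  ndiff k U f -> ndiff k O g -> ndiff k U (g \o f).
Proof.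
move=> Uo fO; elim: k f fO g => [|k IH] f fO g nf ng.
  split=> // x Ux; apply: differentiable_comp.
    exact: ndiff_differentiable nf Ux.
  by apply: ndiff_differentiable ng _; exact: fO.
have df x : U x -> differentiable f x.
  by move=> Ux; exact: ndiff_differentiable nf Ux.
have dg x : U x -> differentiable g (f x).
  by move=> Ux; apply: ndiff_differentiable ng _; exact: fO.
apply: (@ndiffS _ _ _ _ _
  (fun v x => \sum_i ('D_v f x) 0 i *: ('D_(delta_mx 0 i) g \o f) x)) => //.
- by move=> x Ux; apply: differentiable_comp; [exact: df|exact: dg].
- move=> v x Ux; rewrite derive_comp_diff; [|exact: df|exact: dg].
  by rewrite derive_coord //; exact: dg.
- move=> v; apply: ndiff_sum => // i _; apply: ndiffZ => //.
    by apply: ndiff_coord => //; exact: ndiff_derive.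
  by apply: IH => //; [exact: ndiff_weaken|exact: ndiff_derive].
Qed.

Lemma ndiff_det V k n (U : set V) (f : V -> 'M[R]_n) : open U ->
  (forall i j, ndiff k U (fun x => f x i j)) -> ndiff k U (fun x => \det (f x)).
Proof.
move=> Uo nf; apply: ndiff_sum => // s _; apply: ndiffM => //.
  exact: ndiff_cst.
by apply: ndiff_prod.
Qed.

(** Cramer's rule writes the entries of the inverse as polynomials in the
    entries divided by the determinant. *)
Lemma ndiff_invmx V k n (U : set V) (f : V -> 'M[R]_n) : open U ->
  (forall x, U x -> f x \in unitmx) ->
  (forall i j, ndiff k U (fun x => f x i j)) ->
  forall i j, ndiff k U (fun x => invmx (f x) i j).
Proof.
move=> Uo fu nf i j.
apply: (@ndiff_eq _ _ _ _ (fun x => (\det (f x))^-1 *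
   ((-1) ^+ (j + i) * \det (row' j (col' i (f x)))))) => //.
  by move=> x Ux; rewrite /invmx fu // !mxE.
apply: ndiffM => //.
  apply: ndiffV => //; last exact: ndiff_det.
  by move=> x Ux; have := fu x Ux; rewrite unitmxE unitfE.
apply: ndiffM => //; first exact: ndiff_cst.
apply: ndiff_det => // a b.
by apply: ndiff_eq (nf (lift j a) (lift i b)) => // x _; rewrite !mxE.
Qed.

End SmoothCalculus.

(** * Mean value estimates in coordinates *)

Section MeanValue.
Context {R : realType}.
Implicit Types V W : normedModType R.

Lemma mx_norm_entry m n (M : 'M[R]_(m, n)) i j : `|M i j| <= `|M|.
Proof.
rewrite [leRHS]/Num.norm /= mx_normrE.
by apply/bigmax_geP; right => /=; exists (i, j).
Qed.

Lemma mx_norm_le m n (M : 'M[R]_(m, n)) (e : R) : 0 <= e ->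
  (forall i j, `|M i j| <= e) -> `|M| <= e.
Proof.
move=> e0 Me; rewrite [leLHS]/Num.norm /= mx_normrE.
by apply/bigmax_leP; split => //= -[i j] _; exact: Me.
Qed.

Lemma mulmx_bounded m n (N : 'M[R]_(m, n)) :
  exists2 K, 0 < K & forall k : 'rV[R]_m, `|k *m N| <= K * `|k|.
Proof.
pose K := 1 + \sum_i \sum_j `|N i j|.
have S0 i : 0 <= \sum_j `|N i j| by apply: sumr_ge0.
exists K; first by rewrite ltr_wpDr // sumr_ge0.
move=> k; apply: mx_norm_le.
  by rewrite mulr_ge0 // addr_ge0 // sumr_ge0.
move=> i j; rewrite mxE (le_trans (ler_norm_sum _ _ _)) //.
rewrite mulrDl mul1r mulr_suml ler_wpDl // ler_sum // => l _.
rewrite normrM mulrC ler_pM // ?mx_norm_entry //.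
by rewrite (bigD1 j) //= lerDl sumr_ge0.
Qed.

Lemma mulmxr_continuous m n (N : 'M[R]_(m, n)) :
  continuous (fun k : 'rV[R]_m => k *m N).
Proof.
have [K K0 NK] := mulmx_bounded N.
move=> k; apply/(@cvgrPdist_le _ _ _ (nbhs k)) => e e0.
have /(@cvgrPdist_le _ _ _ (nbhs k))/(_ (K^-1 * e)) :
  (id : 'rV[R]_m -> _) @ k --> k by exact: cvg_id.
rewrite mulr_gt0 ?invr_gt0 // => /(_ isT); apply: filterS => l /= kl.
by rewrite -mulmxBl (le_trans (NK _)) // -ler_pdivlMl.
Qed.

Lemma segment_derive V (f : V -> R) (x w : V) (t : R) :
  differentiable f (x + t *: w) ->
  is_derive t 1 (fun s => f (x + s *: w)) ('D_w f (x + t *: w)).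
Proof.
move=> df.
have dl : differentiable (fun s : R => x + s *: w) t.
  by apply: differentiableD => //; exact: differentiableZl.
have dw : 'D_1 (fun s : R => x + s *: w) t = w.
  rewrite (@deriveD _ _ _ (cst x) (fun s : R => s *: w)) //; last first.
    by apply: diff_derivable; exact: differentiableZl.
  rewrite derive_cst add0r deriveE; last exact: differentiableZl.
  by rewrite diffZl // diff_val scale1r.
split; first by apply: diff_derivable; exact: (differentiable_comp dl df).
by have := @derive_comp_diff R R V R _ f t 1 dl df; rewrite dw.
Qed.

Lemma mean_value_segment V (f : V -> R) (x w : V) :
  (forall t, 0 <= t <= 1 -> differentiable f (x + t *: w)) ->
  exists2 t, 0 < t < 1 & f (x + w) - f x = 'D_w f (x + t *: w).
Proof.
move=> df.
have [||t t01 E] := @MVT R (fun s => f (x + s *: w))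
  (fun s => 'D_w f (x + s *: w)) 0 1 ltr01.
- move=> t /[!in_itv]/= /andP[t0 t1]; apply: segment_derive; apply: df.
  by rewrite !ltW.
- apply: derivable_within_continuous => t /[!in_itv]/= t01.
  by have [] := segment_derive (df _ t01).
by exists t; [move: t01; rewrite in_itv|move: E; rewrite scale1r scale0r addr0 subr0 mulr1].
Qed.

Lemma ball_segment V (x0 x y : V) (r t : R) : 0 <= t <= 1 ->
  `|x - x0| <= r -> `|y - x0| <= r -> `|x + t *: (y - x) - x0| <= r.
Proof.
move=> /andP[t0 t1] xr yr.
have -> : x + t *: (y - x) - x0 = (1 - t) *: (x - x0) + t *: (y - x0).
  rewrite scalerBl scale1r -[RHS]addrA [- _ + _]addrC -scalerBr opprB subrKA.
  by rewrite addrAC.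
rewrite (le_trans (ler_normD _ _)) // !normrZ !ger0_norm ?subr_ge0 //.
by rewrite (le_trans (lerD (ler_wpM2l _ xr) (ler_wpM2l _ yr))) ?subr_ge0 // -mulrDl subrK mul1r.
Qed.

(** The partial derivatives vanish at x0 and are continuous, hence are at most
    1/(2(n+1)) near x0; the mean value theorem, applied to each entry along
    segments, sums these bounds to the constant 1/2. *)
Lemma contracting_near n (e : 'rV[R]_n -> 'rV[R]_n) (U : set 'rV[R]_n)
    (x0 : 'rV[R]_n) :
  open U -> U x0 -> ndiff 1 U e -> (forall w, 'D_w e x0 = 0) ->
  exists2 r, 0 < r & forall x, `|x - x0| <= r ->
    [/\ U x, forall w, `|'D_w e x| <= `|w| / 2 &
        forall y, `|y - x0| <= r -> `|e x - e y| <= `|x - y| / 2].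
Proof.
move=> Uo Ux0 ne e0.
pose eps : R := 2^-1 / n.+1%:R.
have eps0 : 0 < eps by rewrite divr_gt0 // invr_gt0.
have : \forall x \near x0, U x /\ forall i, `|'D_(delta_mx 0 i) e x| <= eps.
  near=> x; split; first by near: x; exact: open_nbhs_nbhs.
  near: x; apply: filter_forall => i.
  have dc : {for x0, continuous ('D_(delta_mx 0 i) e)}.
    apply: differentiable_continuous.
    exact: (ndiff_differentiable (ndiff_derive _ ne) Ux0).
  move/cvgr_dist_le: dc => /(_ _ eps0); apply: filterS => x.
  by rewrite e0 sub0r normrN.
move=> /nbhs_closedballP[r rP].
exists r%:num => // x xr.
have inr y : `|y - x0| <= r%:num -> U y /\ forall w, `|'D_w e y| <= `|w| / 2.
  move=> yr; have [|Uy ye] := rP y.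
    by rewrite closed_ballE // /closed_ball_ /= distrC.
  split=> // w; rewrite derive_coord; last exact: ndiff_differentiable ne Uy.
  rewrite (le_trans (ler_norm_sum _ _ _)) //.
  apply: (@le_trans _ _ (\sum_(i < n) `|w| * eps)).
    by apply: ler_sum => i _; rewrite normrZ ler_pM // mx_norm_entry.
  rewrite sumr_const card_ord -mulrnAr ler_wpM2l // /eps -mulr_natr -mulrA.
  by rewrite ler_piMr ?invr_ge0 // mulrC ler_pdivrMr // mul1r ler_nat.
have [Ux xe] := inr x xr.
split=> // y yr; rewrite distrC [`|x - y|]distrC; apply: mx_norm_le; first by rewrite divr_ge0.
move=> i j.
have [t /andP[t0 t1]|t t01 yE] := @mean_value_segment _ (fun x => e x i j) x (y - x). 
  have [|Uz _] := inr (x + t *: (y - x)); first by apply: ball_segment => //; rewrite t0.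
  exact: (ndiff_differentiable (ndiff_coord i j Uo ne) Uz).
have tr : `|x + t *: (y - x) - x0| <= r%:num.
  by apply: ball_segment => //; case/andP: t01 => *; rewrite !ltW.
have [Uz ez] := inr _ tr.
move: yE; rewrite [x + (y - x)]addrC subrK !mxE => ->.
have dz := ndiff_differentiable ne Uz.
have -> : 'D_(y - x) (fun x : 'rV_n => e x i j) (x + t *: (y - x)) =
  ('D_(y - x) e (x + t *: (y - x))) i j.
  rewrite derive_mx ?mxE //; exact: diff_derivable.
exact: le_trans (mx_norm_entry _ _ _) (ez _).
Unshelve. all: by end_near. Qed.

End MeanValue.

(** * The smooth inverse function theorem *)

Section InverseFunctionTheorem.
Context {R : realType}.

Definition jacobian_mx m n (f : 'rV[R]_m -> 'rV[R]_n) x : 'M[R]_(m, n) :=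
  \matrix_(i, j) ('D_(delta_mx 0 i) f x) 0 j.

Lemma derive_jacobian_mx m n (f : 'rV[R]_m -> 'rV[R]_n) x w :
  differentiable f x -> 'D_w f x = w *m jacobian_mx f x.
Proof.
move=> df; rewrite derive_coord //; apply/rowP => j.
by rewrite summxE !mxE; apply: eq_bigr => i _; rewrite !mxE.
Qed.

Lemma unitmx_inj n (M : 'M[R]_n) :
  (forall w : 'rV_n, w *m M = 0 -> w = 0) -> M \in unitmx.
Proof. by move=> Mi; rewrite -row_free_unit; apply: inj_row_free. Qed.

Lemma derive_mulmxr m n p (f : 'rV[R]_m -> 'rV[R]_n) (N : 'M[R]_(n, p)) x :
  differentiable f x ->
  differentiable (fun x => f x *m N) x /\
  forall w, 'D_w (fun x => f x *m N) x = 'D_w f x *m N.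
Proof.
move=> df.
have Nc : continuous (mulmxr N : {linear 'rV[R]_n -> 'rV[R]_p}).
  exact: mulmxr_continuous.
have dN y : differentiable (mulmxr N : {linear 'rV[R]_n -> 'rV[R]_p}) y.
  exact: linear_differentiable.
split; first exact: (differentiable_comp df (dN _)).
move=> w; have := derive_comp_diff w df (dN (f x)).
by rewrite (derive_linear _ _ Nc).
Qed.

Lemma ndiff_mulmxr (V : normedModType R) k m n (U : set V) (f : V -> 'rV[R]_m)
  (N : 'M[R]_(m, n)) : open U -> ndiff k U f -> ndiff k U (fun x => f x *m N).
Proof.
move=> Uo nf.
exact: (@ndiff_linear_comp _ _ _ _ k U (mulmxr N) f Uo (@mulmxr_continuous _ _ _ N) nf).
Qed.

(** With x = h y and d = h (y + k) - x, differentiability of f at x gives k =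
    d J + o(d), so d = k J^-1 + o(k) because d = O(k) by the Lipschitz bound.
    Thus the derivative of h at y is J (h y)^-1, and smoothness follows by
    bootstrapping: if h is k times differentiable, so is this derivative. *)
Lemma smooth_inverse n (A B : set 'rV[R]_n) (f h : 'rV[R]_n -> 'rV[R]_n) (K : R) :
  open A -> open B -> smooth A f ->
  (forall x, A x -> forall w, 'D_w f x = 0 -> w = 0) ->
  (forall y, B y -> A (h y) /\ f (h y) = y) ->
  (forall y z, B y -> B z -> `|h y - h z| <= K * `|y - z|) ->
  smooth B h.
Proof.
move=> Ao Bo /smoothP nf finj fh hK.
have df x : A x -> differentiable f x by move=> xD; exact: ndiff_differentiable (nf 0%N) xD.
have Ju x : A x -> jacobian_mx f x \in unitmx.
  move=> Ax; apply: unitmx_inj => w; rewrite -derive_jacobian_mx; last exact: df.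
  exact: finj.
pose N y := invmx (jacobian_mx f (h y)).
have hd y : B y -> differentiable h y /\ forall w, 'D_w h y = w *m N y.
  move=> By; have [Ax fx] := fh y By; set x := h y in Ax fx *.
  apply: (@differentiable_of_estimate _ _ _ h (mulmxr (N y))).
    exact: mulmxr_continuous.
  move=> e e0; have [C C0 NC] := mulmx_bounded (N y).
  pose K1 := `|K| + 1.
  have K0 : 0 < K1 by rewrite ltr_wpDl.
  have e1 : 0 < e / C / K1 by rewrite !divr_gt0.
  have := differentiable_estimate (df x Ax) e1.
  move=> /nbhs_ballP[r /= r0 rP].
  have : \forall k \near (0 : 'rV[R]_n), B (k + y) /\ `|k| < r / K1.
    near=> k; split.
      by near: k; exact: (near_translate (open_nbhs_nbhs (conj Bo By))).
    near: k; apply/nbhs_ballP; exists (r / K1); first exact: divr_gt0.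
    by move=> k; rewrite mx_norm_ball /ball_ /= sub0r normrN.
  apply: filterS => k [Bk kr].
  have hk : `|h (k + y) - x| <= K1 * `|k|.
    apply: (le_trans (hK _ _ Bk By)); rewrite addrK ler_wpM2r //.
    by rewrite (le_trans (ler_norm K)) // lerDl.
  have := rP (h (k + y) - x); rewrite mx_norm_ball /ball_ /= sub0r normrN.
  rewrite subrK (proj2 (fh _ Bk)) fx addrK derive_jacobian_mx; last exact: df.
  move=> /(_ (le_lt_trans hk _)); rewrite mulrC -ltr_pdivlMr // => /(_ kr).
  set d := h (k + y) - x => kd.
  have -> : d - k *m N y = - ((k - d *m jacobian_mx f x) *m N y).
    by rewrite mulmxBl mulmxK ?opprB //; exact: Ju.
  rewrite normrN (le_trans (NC _)) //.
  apply: (@le_trans _ _ (C * (e / C / K1 * (K1 * `|k|)))).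
    by rewrite ler_pM2l // (le_trans kd) // ler_pM2l.
  by rewrite le_eqVlt; apply/orP; left; apply/eqP; field; rewrite !gt_eqF.
apply/smoothP; elim=> [|k IH].
  by split=> // y /hd[].
apply: (@ndiffS _ _ _ _ _ _ (fun v y => v *m N y)) => //.
- by move=> y /hd[].
- by move=> v y /hd[_]; exact.
- have NA i j : ndiff k A (fun x => invmx (jacobian_mx f x) i j).
    apply: ndiff_invmx => // a b.
    apply: (@ndiff_eq _ _ _ _ _ (fun x => ('D_(delta_mx 0 a) f x) 0 b)) => //.
      by move=> x _; rewrite mxE.
    by apply: ndiff_coord => //; apply: ndiff_derive; exact: nf.
  move=> v; apply: ndiff_coordP => // i j.
  apply: (@ndiff_eq _ _ _ _ _ (fun y => \sum_l v i l * N y l j)) => //.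
    by move=> y _; rewrite mxE.
  apply: ndiff_sum => // l _; apply: ndiffM => //; first exact: ndiff_cst.
  by apply: (ndiff_comp Bo _ IH (NA l j)) => y /fh[].
Unshelve. all: by end_near. Qed.

Lemma differentiable_norm_continuous (V W : normedModType R) (f : V -> W) x :
  differentiable f x -> {for x, continuous (fun x => `|f x|)}.
Proof. by move=> /differentiable_continuous fc; exact: (cvg_norm fc). Qed.

Lemma open_preimage_within (V W : topologicalType) (U : set V) (O : set W)
    (g : V -> W) : open U -> open O ->
  (forall x, U x -> {for x, continuous g}) -> open (U `&` g @^-1` O).
Proof.
move=> Uo Oo gc; rewrite openE => x [Ux Ox]; apply: filterI.
  exact: open_nbhs_nbhs.
by apply: (gc x Ux); exact: open_nbhs_nbhs.
Qed.

(** Let N be the inverse Jacobian matrix at x0. The map e x = f x N - x has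
    zero derivative at x0, so it contracts distances by 1/2 on a small closed
    ball. There, f x = y means x is fixed by T x = y N - e x. The displacement
    |T x - x| attains its minimum on the compact ball, and applying T halves
    it, so the minimum is zero. The contraction also makes f injective with a
    Lipschitz inverse. *)
Theorem inverse_function n (U : set 'rV[R]_n) (f : 'rV[R]_n -> 'rV[R]_n)
    (x0 : 'rV[R]_n) :
  open U -> U x0 -> smooth U f -> (forall w, 'D_w f x0 = 0 -> w = 0) ->
  exists (A B : set 'rV[R]_n) (h : 'rV[R]_n -> 'rV[R]_n),
    [/\ [/\ open A, A x0 & A `<=` U], open B, smooth B h,
        forall x, A x -> B (f x) /\ h (f x) = x &
        forall y, B y -> A (h y) /\ f (h y) = y].
Proof.
move=> Uo Ux0 sf finj; have nf := proj1 (smoothP _ _) sf.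
have df x : U x -> differentiable f x by move=> xD; exact: ndiff_differentiable (nf 0%N) xD.
have Ju : jacobian_mx f x0 \in unitmx.
  apply: unitmx_inj => w; rewrite -derive_jacobian_mx; last exact: df.
  exact: finj.
pose N := invmx (jacobian_mx f x0).
have Nu : N \in unitmx by rewrite unitmx_inv.
pose e x := f x *m N - x.
have de x w : U x -> differentiable e x /\ 'D_w e x = 'D_w f x *m N - w.
  move=> Ux; have [dN DN] := derive_mulmxr N (df x Ux).
  have did : differentiable (id : 'rV[R]_n -> _) x by [].
  split; first exact: (differentiableB dN did).
  rewrite (@deriveB _ _ _ (fun x => f x *m N) id); [|exact: diff_derivable..].
  by rewrite DN derive_id.
have ne : ndiff 1 U e.
  apply: (@ndiffD _ _ _ _ _ (fun x => f x *m N) -%R) => //.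
    by apply: ndiff_mulmxr => //; exact: nf.
  apply: (@ndiff_linear _ _ _ _ _ (-%R : {linear 'rV[R]_n -> 'rV[R]_n})).
  by move=> x; exact: oppr_continuous.
have e0 w : 'D_w e x0 = 0.
  have [_ ->] := de x0 w Ux0; rewrite derive_jacobian_mx; last exact: df.
  by rewrite mulmxK ?subrr.
have [r r0 rP] := contracting_near Uo Ux0 ne e0.
have inC x y : `|x - x0| <= r -> `|y - x0| <= r ->
    `|x - y| / 2 <= `|(f x - f y) *m N|.
  move=> xr yr; have [_ _ /(_ y yr) exy] := rP x xr.
  have -> : (f x - f y) *m N = (e x - e y) + (x - y).
    rewrite /e mulmxBl opprB [RHS](AC (2*2*2) ((1*4)*(5*2)*(3*6))) /=.
    by rewrite !subrr !addr0.
  have := lerB_normD (x - y) (e x - e y); rewrite [x - y + _]addrC.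
  by move: exy; lra.
have sol y : `|(y - f x0) *m N| < r / 2 ->
    exists2 x, `|x - x0| < r & f x = y.
  move=> yr.
  pose C := [set x : 'rV[R]_n | `|x - x0| <= r].
  pose T x := x - (f x - y) *m N.
  have TE x : T x = y *m N - e x.
    by rewrite /T /e mulmxBl !opprB addrCA.
  have TC x : C x -> C (T x).
    rewrite /C /= => xr; have [_ _ /(_ x0)] := rP x xr.
    rewrite subrr normr0 ltW // => /(_ isT) exx0.
    have -> : T x - x0 = (y - f x0) *m N - (e x - e x0).
      rewrite /T /e !mulmxBl !opprB.
      by rewrite [RHS](AC (2*(2*2)) ((5*(1*6))*4*(3*2))) /= subrr addr0.
    rewrite (le_trans (ler_normB _ _)) //.
    apply: (le_trans (lerD (ltW yr) exx0)).
    by rewrite [leRHS]splitr lerD2l ler_pM2r.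
  have Cc : compact C.
    apply: bounded_closed_compact.
      exists (`|x0| + r); split; first exact: num_real.
      move=> M xM x /= xr; rewrite -[x](subrK x0) (le_trans (ler_normD _ _)) //.
      by rewrite addrC (le_trans _ (ltW xM)) // lerD2l.
    have -> : C = closed_ball x0 r.
      by rewrite closed_ballE //; apply/seteqP; split => x; rewrite /C /closed_ball_ /= distrC.
    exact: closed_ball_closed.
  have [c Cc0 cmin] : exists2 c, c \in C & forall x, x \in C -> `|T c - c| <= `|T x - x|.
    apply: (@EVT_min_rV R n (fun x => `|T x - x|)) => //.
      by exists x0; rewrite /C /= subrr normr0 ltW.
    apply: continuous_in_subspaceT => x; rewrite inE => Cx.
    have [Ux _ _] := rP x Cx.
    apply: (@differentiable_norm_continuous _ _ (fun x => T x - x)).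
    have -> : (fun x => T x - x) = (fun x => y *m N - e x - x).
      by apply/funext => z; rewrite TE.
    have [dex _] := de x 0 Ux.
    have did : differentiable (id : 'rV[R]_n -> _) x by [].
    exact: (differentiableB (differentiableB (differentiable_cst _ _) dex) did).
  have {}Cc0 : C c by move: Cc0; rewrite inE.
  have TcC : C (T c) by exact: TC.
  have ETT : T (T c) - T c = e c - e (T c).
    have -> : T (T c) - T c = (y *m N - e (T c)) - (y *m N - e c) by rewrite -!TE.
    by move: (e c) (e (T c)) => a b; rewrite opprB [LHS]addrC subrKA.
  have [Uc _ /(_ (T c) TcC) eTc] := rP c Cc0.
  (* one more step would halve a minimal displacement *)
  have Tcc : T c = c.
    apply/eqP; rewrite -subr_eq0 -normr_le0.
    have := cmin (T c); rewrite inE => /(_ TcC); rewrite ETT.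
    by move: eTc; rewrite [`|c - _|]distrC; lra.
  have fc : f c = y.
    have : (f c - y) *m N = 0.
      by move/eqP: Tcc; rewrite /T -subr_eq0 addrAC subrr sub0r oppr_eq0 => /eqP.
    move=> /(congr1 (mulmx^~ (jacobian_mx f x0))).
    by rewrite mulmxKV // mul0mx => /eqP; rewrite subr_eq0 => /eqP.
  exists c => //.
  have := inC c x0 Cc0; rewrite subrr normr0 ltW // => /(_ isT).
  by rewrite fc; lra.
have [h hP] : {h : 'rV[R]_n -> 'rV[R]_n &
    forall y, `|(y - f x0) *m N| < r / 2 -> `|h y - x0| < r /\ f (h y) = y}.
  apply: (@choice _ _ (fun y x => `|(y - f x0) *m N| < r / 2 -> `|x - x0| < r /\ f x = y)) => y.
  have [/sol[x xr fx]|yr] := boolP (`|(y - f x0) *m N| < r / 2).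
    by exists x.
  by exists x0.
pose B := [set y | `|(y - f x0) *m N| < r / 2].
pose A := [set x | `|x - x0| < r /\ B (f x)].
have AU : A `<=` U by move=> x [/ltW xr _]; have [] := rP x xr.
have Bo : open B.
  have -> : B = setT `&` [set y | `|(y - f x0) *m N| < r / 2] by rewrite setTI.
  apply: (@open_preimage_within _ _ _ [set t | t < r / 2]) => //.
    exact: openT.
  move=> y _; apply: (@differentiable_norm_continuous _ _ (fun y => (y - f x0) *m N)).
  by have [] := @derive_mulmxr _ _ _ (fun y => y - f x0) N y _.
have Ao : open A.
  apply: (@open_preimage_within _ _ [set x | `|x - x0| < r] B) => //.
    have -> : [set x | `|x - x0| < r] = setT `&` [set x | `|x - x0| < r] by rewrite setTI.
    apply: (@open_preimage_within _ _ _ [set t | t < r]) => //.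
      exact: openT.
    by move=> x _; apply: (@differentiable_norm_continuous _ _ (fun x => x - x0)).
  move=> x /= /ltW xr; apply: differentiable_continuous; apply: df.
  by have [] := rP x xr.
have fh y : B y -> A (h y) /\ f (h y) = y.
  by move=> By; have [hr fy] := hP y By; rewrite /A /= fy.
exists A, B, h; split => //.
- split=> //; rewrite /A /B /= !subrr normr0 mul0mx normr0.
  by rewrite divr_gt0.
- have [K K0 NK] := mulmx_bounded N.
  apply: (@smooth_inverse _ A B f h (2 * K)) => //.
  + by apply/smoothP => k; apply: ndiff_subset (nf k).
  + move=> x Ax w Dw; have Ux := AU x Ax; case: Ax => /ltW xr _.
    have [_ /(_ w) ew _] := rP x xr.
    have [_ E] := de x w Ux; move: ew; rewrite E Dw mul0mx sub0r normrN => ew.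
    by apply/eqP; rewrite -normr_le0; lra.
  + move=> y z By Bz; have [yr fy] := hP y By; have [zr fz] := hP z Bz.
    have := inC _ _ (ltW yr) (ltW zr); rewrite fy fz.
    by have := NK (y - z); lra.
- move=> x [xr Bx]; split=> //; have [hr fx] := hP _ Bx.
  have := inC _ _ (ltW hr) (ltW xr); rewrite fx subrr mul0mx normr0 => hx.
  by apply/eqP; rewrite -subr_eq0 -normr_le0; lra.
Qed.
End InverseFunctionTheorem.

(** * The smooth implicit function theorem *)

Section ImplicitFunction.
Context {R : realType}.

Lemma ndiff_id (V : normedModType R) k (U : set V) : ndiff k U id.
Proof.
by apply: (@ndiff_linear _ _ _ _ _ (idfun : {linear V -> V})) => x; exact: cvg_id.
Qed.

Lemma mulmx_row_inl n m (x : 'rV[R]_n) : x *m row_mx 1%:M 0 = row_mx x (0 : 'rV_m).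
Proof. by rewrite mul_mx_row mulmx1 mulmx0. Qed.

Lemma mulmx_row_inr n m (y : 'rV[R]_m) : y *m row_mx 0 1%:M = row_mx (0 : 'rV_n) y.
Proof. by rewrite mul_mx_row mulmx1 mulmx0. Qed.

Lemma mulmx_col_projl n m (z : 'rV[R]_(n + m)) : z *m col_mx 1%:M 0 = lsubmx z.
Proof. by rewrite -{1}(hsubmxK z) mul_row_col mulmx1 mulmx0 addr0. Qed.

Lemma mulmx_col_projr n m (z : 'rV[R]_(n + m)) : z *m col_mx 0 1%:M = rsubmx z.
Proof. by rewrite -{1}(hsubmxK z) mul_row_col mulmx1 mulmx0 add0r. Qed.

Lemma row_mx_norm_lt n m (x : 'rV[R]_n) (y : 'rV[R]_m) (r : R) : 0 < r ->
  `|x| < r -> `|y| < r -> `|row_mx x y| < r.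
Proof.
move=> r0 xr yr; apply: (@le_lt_trans _ _ (Num.max `|x| `|y|)); last first.
  by rewrite gt_max xr yr.
apply: mx_norm_le; first by rewrite le_max normr_ge0.
move=> i j; rewrite mxE le_max; case: splitP => k _.
  by rewrite mx_norm_entry.
by rewrite mx_norm_entry orbT.
Qed.

Lemma open_norm_ball (V : normedModType R) (x0 : V) (r : R) :
  open [set x | `|x - x0| < r].
Proof.
have -> : [set x | `|x - x0| < r] = setT `&` [set x | `|x - x0| < r].
  by rewrite setTI.
apply: (@open_preimage_within _ _ _ [set t | t < r]) => //; first exact: openT.
by move=> x _; apply: (@differentiable_norm_continuous _ _ _ (fun x => x - x0)).
Qed.

(** The map z = (x, y) |-> (x, F z) satisfies the hypothesis of the inverse
    function theorem, and g x is the second component of the preimage of (x,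
    0). *)
Theorem implicit_function n m (U : set 'rV[R]_(n + m))
    (F : 'rV[R]_(n + m) -> 'rV[R]_m) (x0 : 'rV[R]_n) (y0 : 'rV[R]_m) :
  open U -> U (row_mx x0 y0) -> smooth U F -> F (row_mx x0 y0) = 0 ->
  (forall w, 'D_(row_mx 0 w) F (row_mx x0 y0) = 0 -> w = 0) ->
  exists (V : set 'rV[R]_n) (W : set 'rV[R]_m) (g : 'rV[R]_n -> 'rV[R]_m),
    [/\ open V /\ V x0, open W /\ W y0, smooth V g,
        forall x, V x -> W (g x) &
        forall x y, V x -> W y -> U (row_mx x y) /\ (F (row_mx x y) = 0 <-> y = g x)].
Proof.
move=> Uo Uz /smoothP nF F0 Finj.
pose P : 'M[R]_(n + m) := col_mx 1%:M 0 *m row_mx 1%:M 0.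
pose Q : 'M[R]_(m, n + m) := row_mx 0 1%:M.
pose Phi z := z *m P + F z *m Q.
have PhiE z : Phi z = row_mx (lsubmx z) (F z).
  by rewrite /Phi mulmxA mulmx_col_projl mulmx_row_inl mulmx_row_inr add_row_mx addr0 add0r.
have sPhi : smooth U Phi.
  apply/smoothP => k; apply: ndiffD => //; apply: ndiff_mulmxr => //.
  exact: ndiff_id.
have dF : differentiable F (row_mx x0 y0) by exact: ndiff_differentiable (nF 0%N) Uz.
have Phi_inj w : 'D_w Phi (row_mx x0 y0) = 0 -> w = 0.
  have did : differentiable (id : 'rV[R]_(n + m) -> _) (row_mx x0 y0) by [].
  have [d1 D1] := derive_mulmxr P did; have [d2 D2] := derive_mulmxr Q dF.
  rewrite (@deriveD _ _ _ (fun z => z *m P) (fun z => F z *m Q)); [|exact: diff_derivable..].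
  rewrite D1 D2 derive_id mulmxA mulmx_col_projl mulmx_row_inl mulmx_row_inr.
  rewrite add_row_mx addr0 add0r -[0]row_mx0 => /eq_row_mx[w1 w2].
  rewrite -[w]hsubmxK w1 in w2 *.
  by rewrite (Finj _ w2).
have [A [B [h [[Ao Az AU] Bo sh AB BA]]]] := inverse_function Uo Uz sPhi Phi_inj.
have /nbhs_ballP[r /= r0 rA] : nbhs (row_mx x0 y0) A by exact: open_nbhs_nbhs.
have inA x y : `|x - x0| < r -> `|y - y0| < r -> A (row_mx x y).
  move=> xr yr; apply: rA; rewrite mx_norm_ball /ball_ /= distrC opp_row_mx add_row_mx.
  exact: row_mx_norm_lt.
pose g x := rsubmx (h (row_mx x 0)).
have Phi0 x y : A (row_mx x y) -> B (row_mx x 0) -> F (row_mx x y) = 0 <-> y = g x.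
  move=> /AB[_ hz] /BA[_]; rewrite PhiE => /eq_row_mx[hl hF]; split.
    move=> Fz; move: hz; rewrite PhiE row_mxKl Fz /g => ->.
    by rewrite row_mxKr.
  move=> ->; have <- // : h (row_mx x 0) = row_mx x (g x).
  by rewrite -[LHS]hsubmxK hl.
pose B0 := [set x | B (row_mx x 0)].
have B0o : open B0.
  have -> : B0 = setT `&` (fun x : 'rV[R]_n => x *m row_mx 1%:M 0) @^-1` B.
    by rewrite setTI; apply/seteqP; split=> x; rewrite /B0 /= mulmx_row_inl.
  apply: (@open_preimage_within _ _ setT B (fun x : 'rV[R]_n => x *m row_mx 1%:M 0)).
  - exact: openT.
  - exact: Bo.
  - move=> x _; exact: mulmxr_continuous.
have ng k : ndiff k B0 g.
  apply: (@ndiff_eq _ _ _ _ _ (fun x => h (x *m row_mx 1%:M 0) *m col_mx 0 1%:M)) => //.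
    by move=> x _; rewrite /g mulmx_row_inl mulmx_col_projr.
  apply: ndiff_mulmxr => //.
  apply: (@ndiff_comp _ _ _ _ _ B0 B (fun x => x *m row_mx 1%:M 0) h) => //.
  - by move=> x; rewrite mulmx_row_inl.
  - apply: ndiff_mulmxr => //.
    exact: ndiff_id.
  - exact: (proj1 (smoothP _ _) sh).
pose W := [set y : 'rV[R]_m | `|y - y0| < r].
pose V := [set x : 'rV[R]_n | `|x - x0| < r] `&` (B0 `&` g @^-1` W).
have Wo : open W by exact: open_norm_ball.
have Vo : open V.
  apply: openI; first exact: open_norm_ball.
  apply: (@open_preimage_within _ _ B0 W g B0o Wo) => x Bx.
  apply: differentiable_continuous.
  exact: ndiff_differentiable (ng 0%N) Bx.
have B0x0 : B0 x0.
  by have [] := AB _ Az; rewrite PhiE row_mxKl F0.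
have gx0 : g x0 = y0 by apply/esym/Phi0.
exists V, W, g; split.
- split=> //; split; first by rewrite /= subrr normr0.
  by split=> //; rewrite /= gx0 /W /= subrr normr0.
- by split=> //; rewrite /W /= subrr normr0.
- apply/smoothP => k; apply: ndiff_subset (ng k).
  by move=> x [_ []].
- by move=> x [_ []].
- move=> x y [xr [Bx _]] yr; have Axy := inA _ _ xr yr.
  by split; [exact: AU|exact: Phi0].
Qed.

End ImplicitFunction.

(** * Integration over the unit interval *)

Section UnitIntegral.
Context {R : realType}.
Implicit Types g : R -> R.

Definition int01 g : R := \int[@lebesgue_measure R]_(t in `[0, 1]) g t.

(** Continuity at each point of the interval, from both sides: stronger than
    continuity within the interval, and stable under the pointwise operations
    used below. *)
Definition cont01 g := forall t : R, 0 <= t <= 1 -> {for t, continuous g}.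

Lemma cont01_within g : cont01 g -> {within `[0, 1], continuous g}.
Proof.
move=> gc; apply: continuous_in_subspaceT => t; rewrite inE /= in_itv /=.
exact: gc.
Qed.

Lemma cont01_integrable g : cont01 g ->
  (@lebesgue_measure R).-integrable `[0, 1] (EFin \o g).
Proof.
move=> gc; apply: continuous_compact_integrable; first exact: segment_compact.
exact: cont01_within.
Qed.

Lemma int01D g1 g2 : cont01 g1 -> cont01 g2 ->
  int01 (fun t => g1 t + g2 t) = int01 g1 + int01 g2.
Proof. by move=> c1 c2; apply: RintegralD => //; exact: cont01_integrable. Qed.

Lemma int01Z g (a : R) : cont01 g -> int01 (fun t => a * g t) = a * int01 g.
Proof. by move=> c; apply: RintegralZl => //; exact: cont01_integrable. Qed.

Lemma int01_bound g (C : R) : cont01 g ->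
  (forall t : R, 0 <= t <= 1 -> `|g t| <= C) -> `|int01 g| <= C.
Proof.
move=> gc gC; apply: (le_trans (le_normr_Rintegral _ (cont01_integrable gc))) => //.
have -> : C = \int[@lebesgue_measure R]_(t in `[0, 1]) C.
  have E : fine (lebesgue_measure `[0 : R, 1]) = 1.
    by rewrite lebesgue_measure_itv /= lte_fin ltr01 oppr0 adde0.
  by rewrite Rintegral_cst // -[LHS]mulr1; congr (_ * _); rewrite -[LHS]E.

apply: le_Rintegral => //.
- apply: (@cont01_integrable (fun t => `|g t|)) => t t01.
  exact: (cvg_norm (gc t t01)).
- apply: (@cont01_integrable (cst C)) => t _; exact: cvg_cst.
Qed.

Lemma int01_derive g dg : cont01 dg ->
  (forall t : R, 0 <= t <= 1 -> is_derive t 1 g (dg t)) ->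
  int01 dg = g 1 - g 0.
Proof.
move=> dgc gd; rewrite /int01 /Rintegral.
have gc t : 0 <= t <= 1 -> {for t, continuous g}.
  move=> /gd gt; apply: differentiable_continuous; apply/derivable1_diffP.
  exact: ex_derive.
rewrite (@continuous_FTC2 _ dg g 0 1) //.
- exact: cont01_within.
- split.
  + move=> t; rewrite in_itv /= => /andP[t0 t1].
    by have [] := gd t _; rewrite ?ltW.
  + by apply: cvg_at_right_filter; apply: gc; rewrite lexx ler01.
  + by apply: cvg_at_left_filter; apply: gc; rewrite lexx ler01.
- move=> t; rewrite in_itv /= => /andP[t0 t1].
  by rewrite derive1E; have [] := gd t _; rewrite ?ltW.
Qed.

End UnitIntegral.

(** * Uniform Taylor bounds on balls *)

Section Taylor.
Context {R : realType}.

Lemma linear_rV_continuous (W : normedModType R) n (L : {linear 'rV[R]_n -> W}) :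
  continuous L.
Proof.
apply: bounded_linear_continuous; apply/linear_boundedP.
exists (\sum_i `|L (delta_mx 0 i)|); split; first exact: num_real.
move=> M LM x; rewrite {1}(row_sum_delta x) linear_sum (le_trans (ler_norm_sum _ _ _)) //.
apply: (@le_trans _ _ ((\sum_i `|L (delta_mx 0 i)|) * `|x|)); last first.
  by rewrite ler_wpM2r // ltW.
rewrite mulr_suml; apply: ler_sum => i _.
by rewrite linearZ /= normrZ mulrC ler_wpM2l // mx_norm_entry.
Qed.

Let cball n (r : R) := [set x : 'rV[R]_n | `|x| <= r].

Lemma open_oball n (r : R) : open [set x : 'rV[R]_n | `|x| < r].
Proof.
by have := @open_norm_ball R 'rV[R]_n 0 r; under eq_set do rewrite subr0.
Qed.

Lemma continuous_bounded_cball n (g : 'rV[R]_n -> R) (rho : R) : 0 < rho ->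
  (forall x, `|x| <= rho -> {for x, continuous g}) ->
  exists2 C, 0 <= C & forall x, `|x| <= rho -> `|g x| <= C.
Proof.
move=> rho0 gc.
have Kc : compact (@cball n rho).
  apply: bounded_closed_compact.
    exists rho; split; first exact: num_real.
    by move=> M rM x /= xr; rewrite (le_trans xr) // ltW.
  have -> : @cball n rho = closed_ball 0 rho.
    by rewrite closed_ballE //; apply/seteqP; split => x;
      rewrite /cball /closed_ball_ /= sub0r normrN.
  exact: closed_ball_closed.
have [c _ cmax] : exists2 c, c \in @cball n rho &
    forall x, x \in @cball n rho -> `|g x| <= `|g c|.
  apply: (@EVT_max_rV R n (fun x => `|g x|)) => //.
    by exists 0; rewrite /cball /= normr0 ltW.
  apply: continuous_in_subspaceT => x; rewrite inE => Cx.
  exact: (cvg_norm (gc x Cx)).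
by exists `|g c| => // x xr; apply: cmax; rewrite inE.
Qed.

Lemma cball_segment n (x w : 'rV[R]_n) (rho t : R) : 0 <= t <= 1 ->
  `|x| <= rho -> `|x + w| <= rho -> `|x + t *: w| <= rho.
Proof.
move=> t01 xr xwr; have := @ball_segment _ _ 0 x (x + w) rho t t01.
by rewrite !subr0 [x + w - x]addrAC subrr add0r; apply.
Qed.

(** On a compact ball the partial derivatives are bounded, and a ball contains
    the segment between any two of its points. *)
Lemma lipschitz_cball n (g : 'rV[R]_n -> R) (U : set 'rV[R]_n) (rho : R) : 0 < rho ->
  ndiff 1 U g -> (forall x, `|x| <= rho -> U x) ->
  exists2 C, 0 <= C & forall x w, `|x| <= rho -> `|x + w| <= rho ->
     `|g (x + w) - g x| <= C * `|w|.
Proof.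
move=> rho0 ng inU.
have : {C : 'I_n -> R & forall i, 0 <= C i /\
    forall x, `|x| <= rho -> `|'D_(delta_mx 0 i) g x| <= C i}.
  apply: (@choice _ _ (fun i c => 0 <= c /\
    forall x, `|x| <= rho -> `|'D_(delta_mx 0 i) g x| <= c)) => i.
  have [|c c0 cP] := @continuous_bounded_cball n ('D_(delta_mx 0 i) g) rho rho0.
    move=> x /inU Ux; apply: differentiable_continuous.
    exact: ndiff_differentiable (ndiff_derive _ ng) Ux.
  by exists c.
move=> [C CP].
exists (\sum_i C i); first by apply: sumr_ge0 => i _; have [] := CP i.
move=> x w xr xwr.
have [t t01|t /andP[t0 t1] ->] := @mean_value_segment _ _ g x w.
  by apply: (ndiff_differentiable ng); apply: inU; exact: cball_segment.
have zr : `|x + t *: w| <= rho by apply: cball_segment => //; rewrite !ltW.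
rewrite derive_coord; last by apply: (ndiff_differentiable ng); exact: inU.
rewrite (le_trans (ler_norm_sum _ _ _)) // mulr_suml; apply: ler_sum => i _.
rewrite normrZ mulrC ler_pM // ?mx_norm_entry //.
by have [_] := CP i; exact.
Qed.

(** The remainder is D_w g (z) - D_w g (x) for some z of the segment, and the
    partial derivatives are Lipschitz. *)
Lemma taylor_cball n (g : 'rV[R]_n -> R) (U : set 'rV[R]_n) (rho : R) : 0 < rho ->
  ndiff 2 U g -> (forall x, `|x| <= rho -> U x) ->
  exists2 C, 0 <= C & forall x w, `|x| <= rho -> `|x + w| <= rho ->
     `|g (x + w) - g x - 'D_w g x| <= C * `|w| ^+ 2.
Proof.
move=> rho0 ng inU.
have : {C : 'I_n -> R & forall i, 0 <= C i /\
    forall x w, `|x| <= rho -> `|x + w| <= rho ->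
    `|'D_(delta_mx 0 i) g (x + w) - 'D_(delta_mx 0 i) g x| <= C i * `|w|}.
  apply: (@choice _ _ (fun i c => 0 <= c /\
    forall x w, `|x| <= rho -> `|x + w| <= rho ->
    `|'D_(delta_mx 0 i) g (x + w) - 'D_(delta_mx 0 i) g x| <= c * `|w|)) => i.
  have [c c0 cP] := lipschitz_cball rho0 (ndiff_derive (delta_mx 0 i) ng) inU.
  by exists c.
move=> [C CP].
exists (\sum_i C i); first by apply: sumr_ge0 => i _; have [] := CP i.
move=> x w xr xwr.
have dg y : `|y| <= rho -> differentiable g y.
  by move=> /inU Uy; exact: ndiff_differentiable ng Uy.
have [t t01|t /andP[t0 t1] ->] := @mean_value_segment _ _ g x w.
  by apply: dg; exact: cball_segment.
have zr : `|x + t *: w| <= rho by apply: cball_segment => //; rewrite !ltW.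
rewrite !derive_coord; [|exact: dg..].
rewrite -sumrB (le_trans (ler_norm_sum _ _ _)) // mulr_suml; apply: ler_sum => i _.
rewrite -scalerBr normrZ expr2 mulrA mulrC.
have [C0 /(_ x (t *: w) xr zr) Ci] := CP i.
apply: ler_pM => //; last exact: mx_norm_entry.
rewrite (le_trans Ci) // ler_wpM2l // normrZ ger0_norm ?(ltW t0) //.
by rewrite ler_piMl // ltW.
Qed.

End Taylor.

(** * Hadamard's lemma *)

Section Hadamard.
Context {R : realType} (n : nat) (delta : R).
Let B := [set x : 'rV[R]_n | `|x| < delta].

(** The weighted means of g along the segment from 0 to x. The weights t^j
    make the family stable under derivation: the derivative of the j-th mean
    of g is the (j+1)-st mean of the derivative of g. *)
Definition radial_mean (j : nat) (g : 'rV[R]_n -> R) (x : 'rV[R]_n) : R :=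
  int01 (fun t => t ^+ j * g (t *: x)).

Lemma radial_in (x : 'rV[R]_n) (t : R) : 0 <= t <= 1 -> `|x| < delta -> `|t *: x| < delta.
Proof.
move=> /andP[t0 t1] xr; rewrite normrZ ger0_norm //.
by rewrite (le_lt_trans _ xr) // ler_piMl.
Qed.

Lemma radial_derive (g : 'rV[R]_n -> R) (x : 'rV[R]_n) (t : R) :
  ndiff 0 B g -> `|x| < delta -> 0 <= t <= 1 ->
  is_derive t 1 (fun s : R => g (s *: x)) ('D_x g (t *: x)).
Proof.
move=> ng xr t01.
have dg : differentiable g (0 + t *: x).
  rewrite add0r; apply: (ndiff_differentiable ng); exact: radial_in.
have := segment_derive dg; rewrite add0r.
by under eq_fun do rewrite add0r.
Qed.

Lemma radial_cont (j : nat) (g : 'rV[R]_n -> R) (x : 'rV[R]_n) :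
  ndiff 0 B g -> `|x| < delta -> cont01 (fun t => t ^+ j * g (t *: x)).
Proof.
move=> ng xr t t01.
have [d _] := radial_derive ng xr t01.
have gc : {for t, continuous (fun s : R => g (s *: x))}.
  by apply: differentiable_continuous; apply/derivable1_diffP.
by apply: cvgM; [exact: exprn_continuous|exact: gc].
Qed.

Arguments radial_cont j {g x}.

Lemma radial_mean_linear (j : nat) (g : 'rV[R]_n -> R) (x : 'rV[R]_n) :
  ndiff 1 B g -> B x -> linear (fun v => radial_mean j ('D_v g) x : R^o).
Proof.
move=> ng Bx a u v; have nd w := ndiff_derive w ng.
have cu := radial_cont j (nd u) Bx.
rewrite /radial_mean -[X in _ = X + _](int01Z a cu).
rewrite -int01D; last 2 first.
- by move=> t t01; apply: cvgM; [exact: cvg_cst|exact: cu].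
- exact: (radial_cont j (nd v) Bx).
apply: eq_Rintegral => t; rewrite inE /= in_itv /= => t01.
rewrite derive_linear_dir; last first.
  by apply: (ndiff_differentiable ng); exact: radial_in.
by rewrite mulrDr; congr (_ + _); rewrite mulrCA.
Qed.

Arguments radial_mean_linear j {g x}.

(** Derivation under the integral sign: by the uniform Taylor bound, the
    integrand's remainder is O(|h|^2) uniformly in t. *)
Lemma radial_mean_derive (j : nat) (g : 'rV[R]_n -> R) (x : 'rV[R]_n) :
  ndiff 2 B g -> B x -> differentiable (radial_mean j g) x /\
  forall v, 'D_v (radial_mean j g) x = radial_mean j.+1 ('D_v g) x.
Proof.
move=> ng Bx.
have ng1 := ndiff_weaken ng; have ng0 := ndiff_weaken ng1.
have nd v := ndiff_weaken (ndiff_derive v ng).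
have dg (t : R) : 0 <= t <= 1 -> differentiable g (t *: x).
  by move=> t01; apply: (ndiff_differentiable ng0); exact: radial_in.
have Lin := radial_mean_linear j.+1 ng1 Bx.
pose L : {linear 'rV[R]_n -> R^o} := HB.pack (fun v => radial_mean j.+1 ('D_v g) x : R^o)
  (GRing.isLinear.Build R _ R^o _ _ Lin).
apply: (@differentiable_of_estimate _ _ _ (radial_mean j g) L).
  exact: linear_rV_continuous.
move=> e e0.
(* a closed ball containing x and still inside the domain *)
pose rho := (`|x| + delta) / 2.
have xrho : `|x| < rho by rewrite /rho; move: Bx; rewrite /B /=; lra.
have rhod : rho < delta by rewrite /rho; move: Bx; rewrite /B /=; lra.
have rho0 : 0 < rho by exact: le_lt_trans xrho.
have [|C C0 CP] := taylor_cball rho0 ng.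
  by move=> y yr; exact: le_lt_trans yr rhod.
have small (s : R) : 0 < s -> \forall h \near (0 : 'rV[R]_n), `|h| < s.
  move=> s0; apply/nbhs_ballP; exists s => // h.
  by rewrite mx_norm_ball /ball_ /= sub0r normrN.
have C1 : 0 < C + 1 by rewrite ltr_wpDl.
near=> h.
have h1 : `|h| < rho - `|x| by near: h; apply: small; rewrite subr_gt0.
have h2 : `|h| < e / (C + 1) by near: h; apply: small; exact: divr_gt0.
have hx : `|h + x| <= rho.
  by rewrite (le_trans (ler_normD _ _)) // -lerBrDr ltW.
have Bhx : B (h + x) by exact: le_lt_trans hx rhod.
have c1 := radial_cont j ng0 Bhx.
have c2 := radial_cont j ng0 Bx.
have c3 := radial_cont j.+1 (nd h) Bx.
have c4 : cont01 (fun t => -1 * (t ^+ j * g (t *: x))).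
  by move=> t t01; apply: cvgM; [exact: cvg_cst|exact: c2].
have c5 : cont01 (fun t => -1 * (t ^+ j.+1 * 'D_h g (t *: x))).
  by move=> t t01; apply: cvgM; [exact: cvg_cst|exact: c3].
have c6 : cont01 (fun t => t ^+ j * g (t *: (h + x)) + -1 * (t ^+ j * g (t *: x))).
  by move=> t t01; apply: cvgD; [exact: c1|exact: c4].
rewrite [X in `|X|](_ : _ = int01 (fun t => t ^+ j * g (t *: (h + x)) +
  -1 * (t ^+ j * g (t *: x)) + -1 * (t ^+ j.+1 * 'D_h g (t *: x)))); last first.
  by rewrite (int01D c6 c5) (int01D c1 c4) (int01Z (-1) c2) (int01Z (-1) c3) !mulN1r.
apply: int01_bound.
  by move=> t t01; apply: cvgD; [exact: c6|exact: c5].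
move=> t /[dup] t01 /andP[t0 t1].
rewrite !mulN1r.
have -> : t ^+ j * g (t *: (h + x)) - t ^+ j * g (t *: x) - t ^+ j.+1 * 'D_h g (t *: x) =
    t ^+ j * (g (t *: x + t *: h) - g (t *: x) - 'D_(t *: h) g (t *: x)).
  rewrite deriveZv; last exact: dg.
  by rewrite addrC scalerDr exprSr !mulrBr mulrA addrC [t *: x + _]addrC.
have tx : `|t *: x| <= rho.
  by rewrite normrZ ger0_norm // (le_trans _ (ltW xrho)) // ler_piMl.
have txh : `|t *: x + t *: h| <= rho.
  by rewrite -scalerDr normrZ ger0_norm // addrC (le_trans _ hx) // ler_piMl.
have := CP _ _ tx txh; set X := g _ - _ - _ => XC.
have tj : `|t ^+ j| <= 1 by rewrite normrX ger0_norm // exprn_ile1.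
have th : `|t *: h| <= `|h| by rewrite normrZ ger0_norm // ler_piMl.
rewrite normrM (le_trans (ler_wpM2r _ tj)) // mul1r (le_trans XC) //.
apply: (@le_trans _ _ ((C + 1) * `|h| ^+ 2)).
  by rewrite ler_pM // ?exprn_ge0 // ?lerDl // lerXn2r ?nnegrE.
rewrite expr2 mulrA ler_wpM2r // mulrC -ler_pdivlMr //; exact: ltW.
Unshelve. all: by end_near. Qed.

Arguments radial_mean_derive j {g x}.

Lemma radial_mean_smooth (j : nat) (g : 'rV[R]_n -> R) :
  smooth B g -> smooth B (radial_mean j g).
Proof.
move=> /smoothP ng; apply/smoothP => k.
have Bo : open B by exact: open_oball.
elim: k j g ng => [|k IH] j g ng.
  by split=> // x Bx; have [] := radial_mean_derive j (ng 2) Bx.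
apply: (@ndiffS _ _ _ _ _ _ (fun v => radial_mean j.+1 ('D_v g))) => //.
- by move=> x Bx; have [] := radial_mean_derive j (ng 2) Bx.
- by move=> v x Bx; have [_] := radial_mean_derive j (ng 2) Bx; exact.
- by move=> v; apply: IH => i; apply: ndiff_derive; exact: ng.
Qed.

(** Integrate d/dt g (t x) = sum_i x_i D_i g (t x) over the unit interval. *)
Lemma hadamard (g : 'rV[R]_n -> R) : smooth B g ->
  exists G : 'I_n -> 'rV[R]_n -> R, (forall i, smooth B (G i)) /\
  forall x, B x -> g x = g 0 + \sum_i x 0 i * G i x.
Proof.
move=> sg; have ng := proj1 (smoothP _ _) sg.
exists (fun i => radial_mean 0 ('D_(delta_mx 0 i) g)); split.
  move=> i; apply: radial_mean_smooth; apply/smoothP => k.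
  by apply: ndiff_derive; exact: ng.
move=> x Bx.
have c v : cont01 (fun t => 'D_v g (t *: x)).
  have := radial_cont 0 (ndiff_derive v (ng 1%N)) Bx.
  by under eq_fun do rewrite expr0 mul1r.
have := int01_derive (c x) (fun t => radial_derive (ng 0%N) Bx).
rewrite scale1r scale0r => /eqP; rewrite eq_sym subr_eq addrC => /eqP ->.
congr (_ + _).
have E v : int01 (fun t => 'D_v g (t *: x)) = radial_mean 0 ('D_v g) x.
  by apply: eq_Rintegral => t _; rewrite expr0 mul1r.
pose L : {linear 'rV[R]_n -> R^o} := HB.pack (fun v => radial_mean 0 ('D_v g) x : R^o)
  (GRing.isLinear.Build R _ R^o _ _ (radial_mean_linear 0 (ng 1%N) Bx)).
rewrite E -[LHS]/(L x) {1}(row_sum_delta x) linear_sum.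
by apply: eq_bigr => i _; rewrite linearZ.
Qed.
End Hadamard.

(** * Second-order expansions at a critical point *)

Section SecondOrder.
Context {R : realType}.

Lemma derive_sumf (V W : normedModType R) n (f : 'I_n -> V -> W) (x : V) :
  (forall i, differentiable (f i) x) ->
  differentiable (fun y => \sum_i f i y) x /\
  forall v, 'D_v (fun y => \sum_i f i y) x = \sum_i 'D_v (f i) x.
Proof.
move=> df.
have -> : (fun y => \sum_i f i y) = \sum_i f i by apply/funext => y; rewrite fct_sumE.
split; first exact: differentiable_sum.
by move=> v; rewrite derive_sum // => i; exact: diff_derivable.
Qed.

Lemma deriveMf (V : normedModType R) (a b : V -> R) (x : V) :
  differentiable a x -> differentiable b x ->
  differentiable (fun y => a y * b y) x /\
  forall v, 'D_v (fun y => a y * b y) x = 'D_v a x * b x + a x * 'D_v b x.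
Proof. exact: (@differentiable_scale R V R). Qed.

Lemma derive_coordM n (a : 'rV[R]_n -> R) (x : 'rV[R]_n) (i : 'I_n) :
  differentiable a x ->
  differentiable (fun y : 'rV[R]_n => y 0 i * a y) x /\
  forall v : 'rV[R]_n, 'D_v (fun y : 'rV[R]_n => y 0 i * a y) x =
     v 0 i * a x + x 0 i * 'D_v a x.
Proof.
move=> da.
have [d1 D1] := deriveMf (differentiable_coord x 0 i) da.
split=> // v; rewrite D1; congr (_ * _ + _).
have := @derive_mx R _ 1 n id x v (@derivable_id _ _ x v).
by rewrite derive_id => /(congr1 (fun M : 'rV[R]_n => M 0 i)); rewrite mxE.
Qed.

(** Only the terms in which both derivations hit the factors x_i and x_j
    survive at the origin. *)
Lemma hessian_quadratic n (D : set 'rV[R]_n) (f : 'rV[R]_n -> R)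
    (H : 'I_n -> 'I_n -> 'rV[R]_n -> R) : open D -> D 0 ->
  (forall i j, ndiff 1 D (H i j)) ->
  (forall x, D x -> f x = f 0 + \sum_i x 0 i * \sum_j x 0 j * H i j x) ->
  forall u v, 'D_u ('D_v f) 0 =
    \sum_i \sum_j (u 0 i * v 0 j + u 0 j * v 0 i) * H i j 0.
Proof.
move=> Do D0 nH fE u v.
have dH i j x : D x -> differentiable (H i j) x by exact: ndiff_differentiable (nH i j).
have dDH i j x : D x -> differentiable ('D_v (H i j)) x.
  exact: ndiff_differentiable (ndiff_derive v (nH i j)).
have nearD x : D x -> \forall y \near x, D y by move=> Dx; exact: open_nbhs_nbhs.
pose dS i x := \sum_j (v 0 j * H i j x + x 0 j * 'D_v (H i j) x).
have dSum i x : D x -> differentiable (fun y : 'rV[R]_n => \sum_j y 0 j * H i j y) x /\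
    'D_v (fun y : 'rV[R]_n => \sum_j y 0 j * H i j y) x = dS i x.
  move=> Dx.
  have dd j : differentiable (fun y : 'rV[R]_n => y 0 j * H i j y) x.
    by have [] := derive_coordM j (dH i j x Dx).
  have [d E] := derive_sumf dd; split=> //; rewrite E; apply: eq_bigr => j _.
  by have [_ ->] := derive_coordM j (dH i j x Dx).
have Dvf x : D x -> 'D_v f x =
    \sum_i (v 0 i * (\sum_j x 0 j * H i j x) + x 0 i * dS i x).
  move=> Dx.
  rewrite (@near_eq_derive _ _ _ f (fun x => f 0 + \sum_i x 0 i * \sum_j x 0 j * H i j x));
    last by apply: filterS (nearD x Dx) => y /fE.
  have dd i : differentiable (fun y : 'rV[R]_n => y 0 i * \sum_j y 0 j * H i j y) x.
    by have [dsum _] := dSum i x Dx; have [] := derive_coordM i dsum.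
  have [d E] := derive_sumf dd.
  rewrite (@deriveD _ _ _ (cst (f 0)) _ x v); [|exact: derivable_cst|exact: diff_derivable].
  rewrite derive_cst add0r E; apply: eq_bigr => i _.
  by have [dsum Es] := dSum i x Dx; have [_ ->] := derive_coordM i dsum; rewrite Es.
rewrite (near_eq_derive u (filterS Dvf (nearD 0 D0))).
have dS1 i : differentiable (fun y : 'rV[R]_n => \sum_j y 0 j * H i j y) 0 /\
   'D_u (fun y : 'rV[R]_n => \sum_j y 0 j * H i j y) 0 = \sum_j u 0 j * H i j 0.
  have dd j : differentiable (fun y : 'rV[R]_n => y 0 j * H i j y) 0.
    by have [] := derive_coordM j (dH i j 0 D0).
  have [d E] := derive_sumf dd; split=> //; rewrite E; apply: eq_bigr => j _.
  by have [_ ->] := derive_coordM j (dH i j 0 D0); rewrite mxE mul0r addr0.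
have dS2 i : differentiable (dS i) 0.
  have dd j : differentiable (fun x : 'rV[R]_n => v 0 j * H i j x + x 0 j * 'D_v (H i j) x) 0.
    apply: (@differentiableD _ _ _ (fun x => v 0 j * H i j x)
      (fun x : 'rV[R]_n => x 0 j * 'D_v (H i j) x)).
      by have [] := @deriveMf _ (cst (v 0 j)) _ 0 (differentiable_cst _ _) (dH i j 0 D0).
    by have [] := derive_coordM j (dDH i j 0 D0).
  by have [] := derive_sumf dd.
have dT i : differentiable (fun x : 'rV[R]_n => v 0 i * (\sum_j x 0 j * H i j x)) 0 /\
    'D_u (fun x : 'rV[R]_n => v 0 i * (\sum_j x 0 j * H i j x)) 0 =
     v 0 i * \sum_j u 0 j * H i j 0.
  have [d E] := dS1 i.
  have [d' E'] := @deriveMf _ (cst (v 0 i)) _ 0 (differentiable_cst _ _) d.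
  by split=> //; rewrite E' derive_cst mul0r add0r E.
have dTT i : differentiable (fun x : 'rV[R]_n => x 0 i * dS i x) 0 /\
    'D_u (fun x : 'rV[R]_n => x 0 i * dS i x) 0 = u 0 i * dS i 0.
  have [d E] := derive_coordM i (dS2 i).
  by split=> //; rewrite E mxE mul0r addr0.
have dd i : differentiable (fun x : 'rV[R]_n =>
    v 0 i * (\sum_j x 0 j * H i j x) + x 0 i * dS i x) 0.
  by apply: differentiableD; [have [] := dT i|have [] := dTT i].
have [_ ->] := derive_sumf dd; apply: eq_bigr => i _.
rewrite (@deriveD _ _ _ 
  (fun x : 'rV[R]_n => v 0 i * (\sum_j x 0 j * H i j x))
  (fun x : 'rV[R]_n => x 0 i * dS i x));
  [|by apply: diff_derivable; have [] := dT i|by apply: diff_derivable; have [] := dTT i].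
have [_ ->] := dT i; have [_ ->] := dTT i.
rewrite !mulr_sumr -big_split; apply: eq_bigr => j _ /=.
by rewrite mxE mul0r addr0; ring.
Qed.

(** The coefficients of Hadamard's lemma take the values of the first
    derivatives at 0, which vanish, so the lemma applies to them once more. *)
Lemma hadamard2 n (U : set 'rV[R]_n) (f : 'rV[R]_n -> R) : open U -> U 0 ->
  smooth U f -> (forall w, 'D_w f 0 = 0) ->
  exists (D : set 'rV[R]_n) (H : 'I_n -> 'I_n -> 'rV[R]_n -> R),
    [/\ open D, D 0, D `<=` U, forall i j, smooth D (H i j) &
      forall x, D x -> f x = f 0 + \sum_i x 0 i * \sum_j x 0 j * H i j x].
Proof.
move=> Uo U0 /smoothP nf f0.
have /nbhs_ballP[r /= r0 rU] : nbhs (0 : 'rV[R]_n) U by exact: open_nbhs_nbhs.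
pose D := [set x : 'rV[R]_n | `|x| < r].
have DU : D `<=` U.
  by move=> x xr; apply: rU; rewrite mx_norm_ball /ball_ /= sub0r normrN.
have Do : open D by exact: open_oball.
have D0 : D 0 by rewrite /D /= normr0.
have sf : smooth D f by apply/smoothP => k; apply: ndiff_subset (nf k).
have [G [sG fG]] := hadamard sf.
have dG i x : D x -> differentiable (G i) x.
  by move=> Dx; have [d _] := proj1 (smoothP _ _) (sG i) 0%N; exact: d.
have G0 i : G i 0 = 0.
  have := f0 (delta_mx 0 i).
  rewrite (@near_eq_derive _ _ _ f (fun x => f 0 + \sum_i x 0 i * G i x)); last first.
    by apply: filterS (open_nbhs_nbhs (conj Do D0)) => y /fG.
  have dd j : differentiable (fun y : 'rV[R]_n => y 0 j * G j y) 0.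
    by have [] := derive_coordM j (dG j 0 D0).
  have [d E] := derive_sumf dd.
  rewrite (@deriveD _ _ _ (cst (f 0)) _ 0); [|exact: derivable_cst|exact: diff_derivable].
  rewrite derive_cst add0r E (bigD1 i) //= big1 => [|j ji].
    have [_ ->] := derive_coordM i (dG i 0 D0).
    by rewrite !mxE !eqxx mul0r mul1r !addr0.
  have [_ ->] := derive_coordM j (dG j 0 D0).
  by rewrite !mxE (negbTE ji) andbF !mul0r addr0.
have [H HP] : {H : 'I_n -> 'I_n -> 'rV[R]_n -> R & forall i,
    (forall j, smooth D (H i j)) /\
    forall x, D x -> G i x = G i 0 + \sum_j x 0 j * H i j x}.
  apply: (@choice _ _ (fun i (h : 'I_n -> 'rV[R]_n -> R) =>
    (forall j, smooth D (h j)) /\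
    forall x, D x -> G i x = G i 0 + \sum_j x 0 j * h j x)) => i.
  exact: hadamard (sG i).
exists D, H; split => // [i j|x Dx].
  by have [] := HP i.
rewrite (fG x Dx); congr (_ + _); apply: eq_bigr => i _; congr (_ * _).
by have [_ /(_ x Dx) ->] := HP i; rewrite G0 add0r.
Qed.

End SecondOrder.

(** * Planar Morse functions *)

Section Morse.
Context {R : realType}.
Implicit Types (U : set 'rV[R]_2) (f : 'rV[R]_2 -> R).

Lemma sum_ord2 (V : nmodType) (F : 'I_2 -> V) : \sum_i F i = F 0 + F 1.
Proof.
rewrite !big_ord_recl big_ord0 addr0; congr (F _ + F _); exact: val_inj.
Qed.

Lemma sign_witness (a : R) : a != 0 -> exists e : bool, 0 < (-1) ^+ e * a.
Proof.
rewrite neq_lt => /orP[a0|a0].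
  by exists true; rewrite expr1 mulN1r oppr_gt0.
by exists false; rewrite expr0 mul1r.
Qed.

(** Write f = f 0 + a x^2 + 2 b x y + c y^2 with smooth a, b, c and complete
    the square: f - f 0 = a (x + (b/a) y)^2 + (c - b^2/a) y^2. The hypotheses
    say that a and d = c - b^2/a do not vanish at 0, so the square roots of
    their absolute values are smooth there and turn the two squared forms into
    local coordinates. *)
Lemma morse_plane U f (fxx fxy fyy : R) :
  open U -> U 0 -> smooth U f -> (forall w, 'D_w f 0 = 0) ->
  'D_par0 ('D_par0 f) 0 = fxx -> 'D_par0 ('D_par1 f) 0 = fxy ->
  'D_par1 ('D_par1 f) 0 = fyy -> fxx != 0 -> fxx * fyy != fxy ^+ 2 ->
  Ak_singularity 1 f 0.
Proof.
move=> Uo U0 sf f0 Exx Exy Eyy h00 hdet.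
have [D [H [Do D0 DU sH fE]]] := hadamard2 Uo U0 sf f0.
have nH i j := proj1 (smoothP _ _) (sH i j).
pose a := H 0 0; pose b x := (H 0 1 x + H 1 0 x) / 2; pose c := H 1 1.
have na k : ndiff k D a by exact: nH.
have nb k : ndiff k D b.
  apply: (@ndiffM _ _ _ _ (fun x => H 0 1 x + H 1 0 x)) => //; last exact: ndiff_cst.
  by apply: ndiffD => //; exact: nH.
have nc k : ndiff k D c by exact: nH.
have fE0 := fE.
have {}fE x : D x -> f x = f 0 +
    (a x * x 0 0 ^+ 2 + 2 * b x * x 0 0 * x 0 1 + c x * x 0 1 ^+ 2).
  by move=> /fE ->; rewrite !sum_ord2 /a /b /c; field.
have hess u v : 'D_u ('D_v f) 0 =
    2 * (a 0 * (u 0 0 * v 0 0) + b 0 * (u 0 0 * v 0 1 + u 0 1 * v 0 0) +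
         c 0 * (u 0 1 * v 0 1)).
  rewrite (hessian_quadratic Do D0 (fun i j => nH i j 1%N) fE0).
  by rewrite !sum_ord2 /a /b /c; field.
have Hxx : fxx = 2 * a 0 by rewrite -Exx hess /par0 !mxE /=; ring.
have Hxy : fxy = 2 * b 0 by rewrite -Exy hess /par0 /par1 !mxE /=; ring.
have Hyy : fyy = 2 * c 0 by rewrite -Eyy hess /par1 !mxE /=; ring.
have a0 : a 0 != 0 by apply: contraNneq h00 => a0; rewrite Hxx a0 mulr0.
pose d x := c x - b x ^+ 2 / a x.
have d0 : d 0 != 0.
  apply: contraNneq hdet => d0; rewrite Hxx Hxy Hyy; apply/eqP.
  have -> : c 0 = b 0 ^+ 2 / a 0 by apply/eqP; rewrite -subr_eq0 -/(d 0) d0.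
  by field.
have [e1 s1] := sign_witness a0.
have [e2 s2] := sign_witness d0.
(* shrink to where a, and then d, keep the sign they have at 0 *)
pose D1 := D `&` (fun x => (-1) ^+ e1 * a x) @^-1` [set t | 0 < t].
have nsa k : ndiff k D (fun x => (-1) ^+ e1 * a x).
  by apply: ndiffM => //; exact: ndiff_cst.
have D1o : open D1.
  apply: (@open_preimage_within _ _ D [set t : R | 0 < t]) => //.
  move=> x Dx; apply: differentiable_continuous.
  exact: ndiff_differentiable (nsa 0%N) Dx.
have D1a x : D1 x -> a x != 0.
  by move=> [_ /= ax]; apply: contraTneq ax => ->; rewrite mulr0 ltxx.
have D1D : D1 `<=` D by move=> x [].
have na1 k : ndiff k D1 a by exact: ndiff_subset D1D (na k).
have nb1 k : ndiff k D1 b by exact: ndiff_subset D1D (nb k).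
have nc1 k : ndiff k D1 c by exact: ndiff_subset D1D (nc k).
have nd k : ndiff k D1 d.
  apply: (@ndiffD _ _ _ _ _ c (fun x => - (b x ^+ 2 / a x))) => //.
  apply: (@ndiff_eq _ _ _ _ _ (fun x => -1 * (b x * b x * (a x)^-1))) => //.
    by move=> x _; rewrite mulN1r expr2.
  apply: ndiffM => //; first exact: ndiff_cst.
  by apply: ndiffM => //; [exact: ndiffM|exact: ndiffV].
pose D2 := D1 `&` (fun x => (-1) ^+ e2 * d x) @^-1` [set t | 0 < t].
have nsd k : ndiff k D1 (fun x => (-1) ^+ e2 * d x).
  by apply: ndiffM => //; exact: ndiff_cst.
have D2o : open D2.
  apply: (@open_preimage_within _ _ D1 [set t : R | 0 < t]) => //.
  move=> x Dx; apply: differentiable_continuous.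
  exact: ndiff_differentiable (nsd 0%N) Dx.
have D2D1 : D2 `<=` D1 by move=> x [].
have D20 : D2 0 by [].
pose alpha x := Num.sqrt ((-1) ^+ e1 * a x).
pose beta x := alpha x * (b x / a x).
pose gamma x := Num.sqrt ((-1) ^+ e2 * d x).
have nalpha k : ndiff k D2 alpha.
  apply: ndiff_sqrt => //; first by move=> x [[]].
  exact: ndiff_subset D2D1 (ndiff_subset D1D (nsa k)).
have nbeta k : ndiff k D2 beta.
  apply: ndiffM => //; apply: ndiffM => //; first exact: ndiff_subset D2D1 (nb1 k).
  apply: ndiffV => //; first by move=> x /D2D1/D1a.
  exact: ndiff_subset D2D1 (na1 k).
have ngamma k : ndiff k D2 gamma.
  apply: ndiff_sqrt => //; first by move=> x [].
  exact: ndiff_subset D2D1 (nsd k).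
pose Y0 (x : 'rV[R]_2) := x 0 0 * alpha x + x 0 1 * beta x.
pose Y1 (x : 'rV[R]_2) := x 0 1 * gamma x.
pose Y x : 'rV[R]_2 := \row_j (if j == 0 then Y0 x else Y1 x).
have ncoord k i : ndiff k D2 (fun x : 'rV[R]_2 => x 0 i).
  by apply: ndiff_coord => //; exact: ndiff_id.
have nY0 k : ndiff k D2 Y0.
  by apply: (@ndiffD _ _ _ _ _ (fun x : 'rV[R]_2 => x 0 0 * alpha x)
     (fun x : 'rV[R]_2 => x 0 1 * beta x)) => //; apply: ndiffM.
have nY1 k : ndiff k D2 Y1 by exact: ndiffM.
have nY k : ndiff k D2 Y.
  apply: ndiff_coordP => // i j.
  case: (eqVneq j 0) => [->|j0].
    by apply: (@ndiff_eq _ _ _ _ _ Y0) => // x _; rewrite mxE.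
  by apply: (@ndiff_eq _ _ _ _ _ Y1) => // x _; rewrite mxE (negbTE j0).
have dalpha : differentiable alpha 0 by exact: ndiff_differentiable (nalpha 0%N) D20.
have dbeta : differentiable beta 0 by exact: ndiff_differentiable (nbeta 0%N) D20.
have dgamma : differentiable gamma 0 by exact: ndiff_differentiable (ngamma 0%N) D20.
have Yinj w : 'D_w Y 0 = 0 -> w = 0.
  have dY : differentiable Y 0 by exact: ndiff_differentiable (nY 0%N) D20.
  rewrite derive_mx; last exact: diff_derivable.
  move=> Yw; have Yw0 := congr1 (fun M : 'rV[R]_2 => M 0 0) Yw.
  have Yw1 := congr1 (fun M : 'rV[R]_2 => M 0 1) Yw.
  rewrite !mxE in Yw0 Yw1.
  have E0 : (fun x => Y x 0 0) = Y0 by apply/funext => x; rewrite mxE.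
  have E1 : (fun x => Y x 0 1) = Y1 by apply/funext => x; rewrite mxE.
  rewrite E0 in Yw0; rewrite E1 in Yw1.
  have [_ DY1] := derive_coordM 1 dgamma.
  have gamma0 : gamma 0 != 0 by rewrite gt_eqF // sqrtr_gt0.
  have w1 : w 0 1 = 0.
    move: Yw1; rewrite /Y1 DY1 mxE mul0r addr0 => /eqP.
    by rewrite mulf_eq0 (negbTE gamma0) orbF => /eqP.
  have [d1 DY01] := derive_coordM 0 dalpha.
  have [d2 DY02] := derive_coordM 1 dbeta.
  have alpha0 : alpha 0 != 0 by rewrite gt_eqF // sqrtr_gt0.
  have w0 : w 0 0 = 0.
    move: Yw0; rewrite /Y0 (@deriveD _ _ _ (fun x : 'rV[R]_2 => x 0 0 * alpha x)
     (fun x : 'rV[R]_2 => x 0 1 * beta x)); [|exact: diff_derivable..].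
    rewrite DY01 DY02 w1 !mxE !mul0r !addr0 => /eqP.
    by rewrite mulf_eq0 (negbTE alpha0) orbF => /eqP.
  apply/rowP => j; rewrite mxE.
  have /orP[/eqP->|/eqP->] : (j == 0) || (j == 1) by case: j => -[|[|]].
  - exact: w0.
  - exact: w1.
have sY : smooth D2 Y by apply/smoothP.
have [A [B [h [[Ao A0 AD] Bo sh AB BA]]]] := inverse_function D2o D20 sY Yinj.
have Y00 : Y 0 = 0.
  by apply/rowP => j; rewrite !mxE /Y0 /Y1 !mxE !mul0r addr0 if_same.
have [BY0 hY0] := AB 0 A0.
exists B, A, h, Y, e1, e2; split.
  split=> //; [by rewrite -Y00|by rewrite -Y00 hY0|split=> //].
  by apply/smoothP => k; exact: ndiff_subset AD (nY k).
move=> z Bz; have [Ah Yh] := BA z Bz.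
have D2h := AD _ Ah; have D1h := D2D1 _ D2h.
rewrite (fE _ (D1D _ D1h)) -[RHS]addrA; congr (_ + _).
have z0 : z 0 0 = Y0 (h z) by rewrite -{1}Yh mxE.
have z1 : z 0 1 = Y1 (h z) by rewrite -{1}Yh mxE.
have aE : alpha (h z) ^+ 2 = (-1) ^+ e1 * a (h z).
  by rewrite sqr_sqrtr // ltW //; case: D1h.
have gE : gamma (h z) ^+ 2 = (-1) ^+ e2 * d (h z).
  by rewrite sqr_sqrtr // ltW //; case: D2h.
rewrite z0 z1 /Y0 /Y1 /beta.
set x := h z in aE gE *.
have -> : (x 0 0 * alpha x + x 0 1 * (alpha x * (b x / a x))) ^+ 2 =
  alpha x ^+ 2 * (x 0 0 + x 0 1 * (b x / a x)) ^+ 2 by ring.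
rewrite exprMn [x 0 1 ^+ 2 * _]mulrC aE gE -![_ ^+ _ * _ * _]mulrA !signrMK.
have ax := D1a _ D1h.
by rewrite /d; field.
Qed.

Lemma derive_left_inverse n (A : set 'rV[R]_n) (f g : 'rV[R]_n -> 'rV[R]_n) x v :
  open A -> A x -> (forall y, A y -> g (f y) = y) ->
  differentiable f x -> differentiable g (f x) ->
  'D_('D_v f x) g (f x) = v.
Proof.
move=> Ao Ax gf df dg; rewrite -derive_comp_diff // -[RHS](derive_id x v).
by apply: near_eq_derive; apply: filterS (open_nbhs_nbhs (conj Ao Ax)) => y /gf.
Qed.

(** In the coordinates psi of the normal form, the Hessian at the critical
    point is 2 (s1 a_0 b_0 + s2 a_1 b_1), where a and b are the images of the
    two vectors under the derivative of psi. Choosing b = (s1 a_0, s2 a_1), a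
    vector reached because psi is a local diffeomorphism, gives 2 |a|^2. *)
Lemma A1_hessian_inj f v : Ak_singularity 1 f 0 ->
  (forall w, 'D_w ('D_v f) 0 = 0) -> v = 0.
Proof.
move=> [A [B [phi [psi [e1 [e2 [[Ao Bo A0 phi0 [sphi spsi AB BA]] fE]]]]]]] fv.
have [B0 psi0] := AB 0 A0; rewrite phi0 in B0 psi0.
have npsi k : ndiff k B psi by exact: (proj1 (smoothP _ _) spsi).
have nphi k : ndiff k A phi by exact: (proj1 (smoothP _ _) sphi).
pose p (i : 'I_2) (x : 'rV[R]_2) : R := psi x 0 i.
have np k i : ndiff k B (p i) by exact: ndiff_coord.
have dp i x : B x -> differentiable (p i) x.
  by move=> Bx; exact: ndiff_differentiable (np 0%N i) Bx.
have dDp i x : B x -> differentiable ('D_v (p i)) x.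
  by move=> Bx; exact: ndiff_differentiable (ndiff_derive v (np 1%N i)) Bx.
have dpsi : differentiable psi 0 by exact: ndiff_differentiable (npsi 0%N) B0.
have dphi : differentiable phi 0 by exact: ndiff_differentiable (nphi 0%N) A0.
have p0 i : p i 0 = 0 by rewrite /p psi0 mxE.
have pE w i : 'D_w (p i) 0 = ('D_w psi 0) 0 i.
  by rewrite derive_mx ?mxE //; exact: diff_derivable.
pose sg (i : 'I_2) : R := if i == 0 then (-1) ^+ e1 else (-1) ^+ e2.
have sg2 i : sg i * sg i = 1.
  by rewrite /sg; case: ifP => _; rewrite -expr2 sqrr_sign.
have fB x : B x -> f x = f 0 + \sum_i sg i * (p i x * p i x).
  move=> Bx; have [Apsi phipsi] := BA x Bx.
  rewrite -{1}phipsi fE // sum_ord2 /sg /= addrA.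
  by rewrite /p -!expr2.
pose q i x := p i x * 'D_v (p i) x.
have Dvf x : B x -> 'D_v f x = \sum_i (2 * sg i) * q i x.
  move=> Bx.
  rewrite (@near_eq_derive _ _ _ f (fun x => f 0 + \sum_i sg i * (p i x * p i x))); last first.
    by apply: filterS (open_nbhs_nbhs (conj Bo Bx)) => y /fB.
  have dd i : differentiable (fun x => sg i * (p i x * p i x)) x /\
      'D_v (fun x => sg i * (p i x * p i x)) x = 2 * sg i * q i x.
    have [d E] := deriveMf (dp i x Bx) (dp i x Bx).
    have [d' E'] := @deriveMf _ _ (cst (sg i)) _ x (differentiable_cst _ _) d.
    by split=> //; rewrite E' derive_cst mul0r add0r E /q /cst; ring.
  have [d E] := derive_sumf (fun i => proj1 (dd i)).
  rewrite (@deriveD _ _ _ (cst (f 0)) _ x v); [|exact: derivable_cst|exact: diff_derivable].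
  by rewrite derive_cst add0r E; apply: eq_bigr => i _; have [_ ->] := dd i.
have DD w : 'D_w ('D_v f) 0 = \sum_i (2 * sg i) * ('D_w (p i) 0 * 'D_v (p i) 0).
  rewrite (near_eq_derive w (filterS Dvf (open_nbhs_nbhs (conj Bo B0)))).
  have dd i : differentiable (fun x => 2 * sg i * q i x) 0 /\
      'D_w (fun x => 2 * sg i * q i x) 0 = (2 * sg i) * ('D_w (p i) 0 * 'D_v (p i) 0).
    have [d E] := deriveMf (dp i 0 B0) (dDp i 0 B0).
    have [d' E'] := @deriveMf _ _ (cst (2 * sg i)) _ 0 (differentiable_cst _ _) d.
    by split=> //; rewrite E' derive_cst mul0r add0r E p0 mul0r addr0.
  have [d E] := derive_sumf (fun i => proj1 (dd i)).
  by rewrite E; apply: eq_bigr => i _; have [_ ->] := dd i.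
have dpsi' : differentiable psi (phi 0) by rewrite phi0.
have dphi' : differentiable phi (psi 0) by rewrite psi0.
(* the test vector that turns the indefinite form into a sum of squares *)
pose a : 'rV[R]_2 := \row_i (sg i * 'D_v (p i) 0).
have := derive_left_inverse a Ao A0 (fun y Ay => proj2 (AB y Ay)) dphi dpsi'.
rewrite phi0 => Da.
have := fv ('D_a phi 0); rewrite DD sum_ord2 !pE Da !mxE.
set b0 := 'D_v (p 0) 0; set b1 := 'D_v (p 1) 0.
rewrite -!pE -/b0 -/b1.
have -> : 2 * sg 0 * (sg 0 * b0 * b0) + 2 * sg 1 * (sg 1 * b1 * b1) =
  2 * ((sg 0 * sg 0) * b0 ^+ 2 + (sg 1 * sg 1) * b1 ^+ 2) by ring.
rewrite !sg2 !mul1r => /eqP; rewrite mulf_eq0 pnatr_eq0 /= paddr_eq0 ?sqr_ge0 //.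
rewrite !sqrf_eq0 => /andP[/eqP b00 /eqP b10].
have Dv0 : 'D_v psi 0 = 0.
  apply/rowP => j; rewrite -pE mxE.
  have /orP[/eqP->|/eqP->] : (j == 0) || (j == 1) by case: j => -[|[|]].
  - exact: b00.
  - exact: b10.
have := derive_left_inverse v Bo B0 (fun y By => proj2 (BA y By)) dpsi dphi'.
by rewrite Dv0 derive0 => <-.
Qed.

End Morse.

(** * The Euclidean scalar product *)

Section Dot.
Context {R : realType}.

Lemma dotE n (a b : 'rV[R]_n) : dot a b = \sum_i a 0 i * b 0 i.
Proof. by rewrite /dot mxE; apply: eq_bigr => i _; rewrite mxE. Qed.

Lemma dotC n (a b : 'rV[R]_n) : dot a b = dot b a.
Proof. by rewrite !dotE; apply: eq_bigr => i _; rewrite mulrC. Qed.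

Lemma dotDl n (a b c : 'rV[R]_n) : dot (a + b) c = dot a c + dot b c.
Proof. by rewrite /dot mulmxDl mxE. Qed.

Lemma dotZl n k (a c : 'rV[R]_n) : dot (k *: a) c = k * dot a c.
Proof. by rewrite /dot -scalemxAl mxE. Qed.

Lemma dotNl n (a c : 'rV[R]_n) : dot (- a) c = - dot a c.
Proof. by rewrite -scaleN1r dotZl mulN1r. Qed.

Lemma dotBl n (a b c : 'rV[R]_n) : dot (a - b) c = dot a c - dot b c.
Proof. by rewrite dotDl dotNl. Qed.

Lemma dotDr n (a b c : 'rV[R]_n) : dot c (a + b) = dot c a + dot c b.
Proof. by rewrite !(dotC c) dotDl. Qed.

Lemma dotZr n k (a c : 'rV[R]_n) : dot c (k *: a) = k * dot c a.
Proof. by rewrite !(dotC c) dotZl. Qed.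

Lemma dotBr n (a b c : 'rV[R]_n) : dot c (a - b) = dot c a - dot c b.
Proof. by rewrite !(dotC c) dotBl. Qed.

Lemma dot0l n (c : 'rV[R]_n) : dot 0 c = 0.
Proof. by rewrite /dot mul0mx mxE. Qed.

Lemma dot_eq0 n (a : 'rV[R]_n) : dot a a = 0 -> a = 0.
Proof.
rewrite dotE => /eqP; rewrite psumr_eq0 => [/allP a0|i _]; last exact: sqr_ge0.
apply/rowP => i; have := a0 i; rewrite mem_index_enum => /(_ isT).
by rewrite mulf_eq0 orbb mxE => /eqP.
Qed.

Lemma derive_entry (V : normedModType R) n (f : V -> 'rV[R]_n) x i :
  differentiable f x -> differentiable (fun y => f y 0 i) x /\
  forall v, 'D_v (fun y => f y 0 i) x = ('D_v f x) 0 i.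
Proof.
move=> df; split; first exact: (differentiable_comp df (differentiable_coord _ _ _)).
by move=> v; rewrite derive_mx ?mxE //; exact: diff_derivable.
Qed.

Lemma derive_dot (V : normedModType R) n (f g : V -> 'rV[R]_n) x :
  differentiable f x -> differentiable g x ->
  differentiable (fun y => dot (f y) (g y)) x /\
  forall v, 'D_v (fun y => dot (f y) (g y)) x = dot ('D_v f x) (g x) + dot (f x) ('D_v g x).
Proof.
move=> df dg.
have -> : (fun y => dot (f y) (g y)) = (fun y => \sum_i f y 0 i * g y 0 i).
  by apply/funext => y; rewrite dotE.
have dd i : differentiable (fun y => f y 0 i * g y 0 i) x /\
   forall v, 'D_v (fun y => f y 0 i * g y 0 i) x =
     ('D_v f x) 0 i * g x 0 i + f x 0 i * ('D_v g x) 0 i.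
  have [fi Fi] := derive_entry i df; have [gi Gi] := derive_entry i dg.
  by have [d D] := deriveMf fi gi; split=> // v; rewrite D Fi Gi.
have [d D] := derive_sumf (fun i => proj1 (dd i)); split=> // v.
rewrite D !dotE -big_split; apply: eq_bigr => i _.
by have [_ ->] := dd i.
Qed.

Lemma ndiff_dot (V : normedModType R) k (U : set V) n (f g : V -> 'rV[R]_n) :
  open U -> ndiff k U f -> ndiff k U g -> ndiff k U (fun y => dot (f y) (g y)).
Proof.
move=> Uo nf ng.
apply: (@ndiff_eq _ _ _ _ _ (fun y => \sum_i f y 0 i * g y 0 i)) => //.
  by move=> y _; rewrite dotE.
by apply: ndiff_sum => // i _; apply: ndiffM => //; exact: ndiff_coord.
Qed.

Lemma ndiffB (V W : normedModType R) k (U : set V) (f g : V -> W) : open U ->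
  ndiff k U f -> ndiff k U g -> ndiff k U (fun x => f x - g x).
Proof.
move=> Uo nf ng; apply: (@ndiffD _ _ _ _ _ f (fun x => - g x)) => //.
apply: (@ndiff_eq _ _ _ _ _ (fun x => -1 *: g x)) => //.
  by move=> x _; rewrite scaleN1r.
by apply: ndiffZ => //; exact: ndiff_cst.
Qed.

(** The matrix with rows f0, f1, b is invertible and annihilates d. *)
Lemma dot_basis_eq0 (f0 f1 b d : 'rV[R]_3) :
  (forall x y z, x *: f0 + y *: f1 + z *: b = 0 -> [/\ x = 0, y = 0 & z = 0]) ->
  dot d f0 = 0 -> dot d f1 = 0 -> dot d b = 0 -> d = 0.
Proof.
move=> free d0 d1 db.
pose F (i : 'I_3) := nth b [:: f0; f1] i.
pose M : 'M[R]_3 := \matrix_i F i.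
have Mu : M \in unitmx.
  apply: unitmx_inj => w; rewrite mulmx_sum_row !big_ord_recl big_ord0 !rowK /F /= addr0 addrA.
  move=> /free[w0 w1 w2]; apply/rowP => j; rewrite mxE.
  have /or3P[/eqP->|/eqP->|/eqP->] :
    [|| j == ord0, j == lift ord0 ord0 | j == lift ord0 (lift ord0 ord0)].
    by case: j => -[|[|[|]]].
  - exact: w0.
  - exact: w1.
  - exact: w2.
have : d *m M^T = 0.
  apply/rowP => j; rewrite [RHS]mxE.
  have -> : (d *m M^T) 0 j = dot d (F j).
    by rewrite mxE dotE; apply: eq_bigr => k _; rewrite !mxE.
  by rewrite /F; case: j => -[|[|[|]]].
move=> /(congr1 (mulmx^~ (invmx M^T))); rewrite mulmxK ?mul0mx //.
by rewrite unitmx_tr.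
Qed.

End Dot.

(** * Regular patches and their tangent spheres *)

Section Patch.
Context {R : realType}.
Implicit Types (U : set 'rV[R]_2) (p m : 'rV[R]_2 -> 'rV[R]_3).

Lemma par_decomp (w : 'rV[R]_2) : w = w 0 0 *: par0 + w 0 1 *: par1.
Proof. by rewrite {1}(row_sum_delta w) sum_ord2. Qed.

Lemma derive_par (W : normedModType R) (f : 'rV[R]_2 -> W) x w : differentiable f x ->
  'D_w f x = w 0 0 *: 'D_par0 f x + w 0 1 *: 'D_par1 f x.
Proof. by move=> df; rewrite derive_coord // sum_ord2. Qed.

Lemma patch_differentiable U p m x : oriented_patch U p m -> U x ->
  differentiable p x /\ differentiable m x.
Proof. by move=> [_ _ sp sm _] Ux; split; [exact: (sp [::])|exact: (sm [::])]. Qed.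

(** Pairing with the normal kills the tangential part, so z = 0; regularity of
    the parametrization does the rest. *)
Lemma patch_free U p m x y z : oriented_patch U p m ->
  x *: 'D_par0 p 0 + y *: 'D_par1 p 0 + z *: m 0 = 0 -> [/\ x = 0, y = 0 & z = 0].
Proof.
move=> hM; have [_ U0 _ _ /(_ 0 U0)[reg mm mp]] := hM.
have [dp _] := patch_differentiable hM U0.
move=> E.
have z0 : z = 0.
  move: E (mp par0) (mp par1) mm.
  move: ('D_par0 p 0) ('D_par1 p 0) (m 0) => f0 f1 b E b0 b1 bb.
  have := congr1 (dot b) E.
  by rewrite !dotDr !dotZr b0 b1 bb !mulr0 !add0r mulr1 (dotC b) dot0l.
move: E; rewrite z0 scale0r addr0.
pose w : 'rV[R]_2 := x *: par0 + y *: par1.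
have w0 : w 0 0 = x by rewrite !mxE /= mulr1 mulr0 addr0.
have w1 : w 0 1 = y by rewrite !mxE /= mulr1 mulr0 add0r.
rewrite -{1}w0 -{1}w1 -derive_par // => /reg ww.
by split=> //; [rewrite -w0|rewrite -w1]; rewrite ww mxE.
Qed.

(** Subtracting the normal component leaves a vector orthogonal to a basis of
    the space. *)
Lemma normal_multiple U p m a : oriented_patch U p m ->
  (forall w, dot a ('D_w p 0) = 0) -> a = dot a (m 0) *: m 0.
Proof.
move=> hM ap; have [_ U0 _ _ /(_ 0 U0)[_ mm mp]] := hM.
apply/eqP; rewrite -subr_eq0; apply/eqP.
apply: (@dot_basis_eq0 _ ('D_par0 p 0) ('D_par1 p 0) (m 0)).
- by move=> x y z; exact: (patch_free hM).
- by rewrite dotBl dotZl ap mp mulr0 subrr.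
- by rewrite dotBl dotZl ap mp mulr0 subrr.
- by rewrite dotBl dotZl mm mulr1 subrr.
Qed.

(** The vector p 0 - c is normal to the surface and has length r, so it is r m
    or - r m; the orientation of m excludes the first. *)
Lemma sphere_centre U p m c r : oriented_patch U p m -> 0 < r ->
  tangent_sphere c r p 0 -> points_towards c p m 0 -> c = p 0 + r *: m 0.
Proof.
move=> hM r0 [pr pt] mc; have [_ U0 _ _ /(_ 0 U0)[_ mm mp]] := hM.
have E := normal_multiple hM pt.
have kr : dot (p 0 - c) (m 0) ^+ 2 = r ^+ 2.
  by rewrite -pr {2 3}E dotZl dotZr mm mulr1 expr2.
have k0 : dot (p 0 - c) (m 0) < 0.
  by rewrite -opprB dotNl dotC oppr_lt0.
have k : dot (p 0 - c) (m 0) = - r.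
  by move/eqP: kr; rewrite eqf_sqr => /orP[]/eqP // kr; move: k0; rewrite kr ltNge ltW.
by move: E; rewrite k scaleNr => /eqP; rewrite subr_eq addrC -subr_eq opprK => /eqP.
Qed.

End Patch.

(** * The Hessian of the distance function *)

Section Contact.
Context {R : realType}.
Implicit Types (U : set 'rV[R]_2) (q n : 'rV[R]_2 -> 'rV[R]_3).

(** Symmetry of the mixed derivatives is read off the formula of
    hessian_quadratic, whose right-hand side is symmetric in u and v. *)
Lemma critical_hessian_sym k (U : set 'rV[R]_k) (f : 'rV[R]_k -> R) u v :
  open U -> U 0 -> smooth U f -> (forall w, 'D_w f 0 = 0) ->
  'D_u ('D_v f) 0 = 'D_v ('D_u f) 0.
Proof.
move=> Uo U0 sf f0; have [D [H [Do D0 _ sH fE]]] := hadamard2 Uo U0 sf f0.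
have nH i j : ndiff 1 D (H i j) by exact: (proj1 (smoothP _ _) (sH i j)).
rewrite !(hessian_quadratic Do D0 nH fE).
by apply: eq_bigr => i _; apply: eq_bigr => j _; rewrite addrC [u 0 j * _]mulrC [u 0 i * _]mulrC.
Qed.

Definition dist2 c (r : R) q (y : 'rV[R]_2) : R := dot (q y - c) (q y - c) - r ^+ 2.

Lemma patch_ndiff U q n k : oriented_patch U q n -> ndiff k U q /\ ndiff k U n.
Proof. by move=> [_ _ /smoothP sq /smoothP sn _]. Qed.

Lemma smooth_dist2 U q n c r : oriented_patch U q n -> smooth U (dist2 c r q).
Proof.
move=> hN; have [Uo _ _ _ _] := hN; apply/smoothP => k.
have [nq _] := patch_ndiff k hN.
have nqc : ndiff k U (fun y => q y - c) by apply: ndiffB => //; exact: ndiff_cst.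
by apply: ndiffB => //; [exact: ndiff_dot|exact: ndiff_cst].
Qed.

Lemma derive_dist2 c r q x w : differentiable q x ->
  'D_w (dist2 c r q) x = 2 * dot (q x - c) ('D_w q x).
Proof.
move=> dq.
have dqc : differentiable (fun y => q y - c) x by exact: differentiableB.
have Dqc : 'D_w (fun y => q y - c) x = 'D_w q x.
  rewrite (@deriveB _ _ _ q (cst c)); [|exact: diff_derivable|exact: derivable_cst].
  by rewrite derive_cst subr0.
have [d D] := derive_dot dqc dqc.
rewrite (@deriveB _ _ _ (fun y => dot (q y - c) (q y - c)) (cst (r ^+ 2)));
  [|exact: diff_derivable|exact: derivable_cst].
by rewrite D derive_cst subr0 Dqc (dotC ('D_w q x)); ring.
Qed.

(** At the point of tangency q - c = - r n. Differentiating the identity n .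
    D_w q = 0 replaces n . D_v D_w q by - D_v n . D_w q. *)
Lemma dist2_hessian U q n c r v w : oriented_patch U q n ->
  c = q 0 + r *: n 0 ->
  'D_v ('D_w (dist2 c r q)) 0 = 2 * dot ('D_v q 0 + r *: 'D_v n 0) ('D_w q 0).
Proof.
move=> hN cE; have [Uo U0 _ _ hU] := hN.
have dqn x : U x -> differentiable q x /\ differentiable n x.
  by move=> Ux; exact: patch_differentiable hN Ux.
have [dq dn] := dqn 0 U0.
have dDq : differentiable ('D_w q) 0.
  have [nq _] := patch_ndiff 1 hN.
  exact: ndiff_differentiable (ndiff_derive w nq) U0.
have nU : \forall x \near (0 : 'rV[R]_2), U x by exact: open_nbhs_nbhs.
have dqc : differentiable (fun y => q y - c) 0 by exact: differentiableB.
have Dqc : 'D_v (fun y => q y - c) 0 = 'D_v q 0.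
  rewrite (@deriveB _ _ _ q (cst c)); [|exact: diff_derivable|exact: derivable_cst].
  by rewrite derive_cst subr0.
have [d1 D1] := derive_dot dqc dDq.
have [d1' D1'] := @deriveMf _ _ (cst 2) _ 0 (differentiable_cst _ _) d1.
rewrite (@near_eq_derive _ _ _ _ (fun x => cst 2 x * dot (q x - c) ('D_w q x))); last first.
  by apply: filterS nU => x Ux; rewrite derive_dist2 //; have [] := dqn x Ux.
rewrite D1' derive_cst mul0r add0r D1 Dqc /cst.
have [d2 D2] := derive_dot dn dDq.
have : 'D_v (fun x => dot (n x) ('D_w q x)) 0 = 0.
  rewrite (@near_eq_derive _ _ _ _ (cst 0)) ?derive_cst //.
  by apply: filterS nU => x /hU[_ _ /(_ w)].
rewrite D2 => /eqP; rewrite addrC addr_eq0 => /eqP nE.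
rewrite cE opprD addrA subrr add0r -scaleNr dotZl nE.
by rewrite mulrNN dotDl dotZl.
Qed.

(** Since 0 is not umbilic, the curvatures of the two coordinate lines differ,
    and any principal vector must then be along one of these lines. *)
Lemma principal_pair U q n : oriented_patch U q n -> curvature_line_parameters U q n ->
  ~ umbilic q n 0 ->
  exists k0 k1, [/\ 'D_par0 n 0 = - k0 *: 'D_par0 q 0, 'D_par1 n 0 = - k1 *: 'D_par1 q 0,
    k0 <> k1, dot ('D_par0 q 0) ('D_par0 q 0) = 1 /\ dot ('D_par1 q 0) ('D_par1 q 0) = 1 &
    principal_curvatures q n 0 = [set k0; k1]].
Proof.
move=> hN [h0 h1 u0 u1] num; have [Uo U0 _ _ hU] := hN.
have [k0 [p0 n0]] := h0 0 U0; have [k1 [p1 n1]] := h1 0 U0.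
have [dq dn] := patch_differentiable hN U0.
exists k0, k1; split; [exact: n0|exact: n1| | |].
- move=> k01; apply: num; exists k0 => w.
  rewrite (derive_par w dn) (derive_par w dq) n0 n1 -k01.
  move: ('D_par0 q 0) ('D_par1 q 0) => f0 f1.
  by rewrite scalerDr !scalerA [w 0 0 * _]mulrC [w 0 1 * _]mulrC.
- by split; [apply: u0|apply: u1] => //; rewrite mxE.
- apply/seteqP; split=> l.
    move=> [w [w0 wl]].
    have : (w 0 0 * (l - k0)) *: 'D_par0 q 0 + (w 0 1 * (l - k1)) *: 'D_par1 q 0 + 0 *: n 0 = 0.
      have : 'D_w n 0 - (- l *: 'D_w q 0) = 0 by rewrite wl subrr.
      rewrite (derive_par w dn) (derive_par w dq) n0 n1.
      move: ('D_par0 q 0) ('D_par1 q 0) => f0 f1.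
      rewrite -scaleNr opprK scalerDr !scalerA addrACA -!scalerDl scale0r addr0 => E.
      by rewrite -[RHS]E; congr (_ *: _ + _ *: _); ring.
    move=> /(patch_free hN)[E0 E1 _].
    have [w00|w00] := eqVneq (w 0 0) 0; last first.
      left; move/eqP: E0; rewrite mulf_eq0 (negbTE w00) /= subr_eq0 => /eqP.
      exact.
    have w10 : w 0 1 != 0.
      apply: contraNneq w0 => w10; rewrite (par_decomp w) w00 w10.
      by rewrite !scale0r addr0.
    by right; move/eqP: E1; rewrite mulf_eq0 (negbTE w10) /= subr_eq0 => /eqP; exact.
  by move=> [->|->]; [exists par0|exists par1].
Qed.

(** Symmetry of the Hessian forces r (k0 - k1) f0 . f1 = 0, so the two
    principal directions are orthogonal and the Hessian is diagonal in the
    curvature-line parameters. *)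
Lemma dist2_hessian_principal U q n c r k0 k1 u v : oriented_patch U q n ->
  c = q 0 + r *: n 0 -> r != 0 ->
  'D_par0 n 0 = - k0 *: 'D_par0 q 0 -> 'D_par1 n 0 = - k1 *: 'D_par1 q 0 ->
  k0 <> k1 ->
  dot ('D_par0 q 0) ('D_par0 q 0) = 1 -> dot ('D_par1 q 0) ('D_par1 q 0) = 1 ->
  'D_u ('D_v (dist2 c r q)) 0 =
    2 * ((1 - r * k0) * (u 0 0 * v 0 0) + (1 - r * k1) * (u 0 1 * v 0 1)).
Proof.
move=> hN cE r0 n0 n1 k01 q00 q11; have [Uo U0 _ _ hU] := hN.
have [dq dn] := patch_differentiable hN U0.
have F0 w : 'D_w (dist2 c r q) 0 = 0.
  rewrite derive_dist2 // cE opprD addrA subrr add0r -scaleNr dotZl.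
  by have [_ _ ->] := hU 0 U0; rewrite !mulr0.
have q01 : dot ('D_par0 q 0) ('D_par1 q 0) = 0.
  have := etrans (esym (dist2_hessian par0 par1 hN cE))
    (etrans (critical_hessian_sym par0 par1 Uo U0 (smooth_dist2 c r hN) F0)
      (dist2_hessian par1 par0 hN cE)).
  rewrite n0 n1.
  move: ('D_par0 q 0) ('D_par1 q 0) => f0 f1.
  rewrite !dotDl !dotZl (dotC f1 f0); set t := dot _ _ => E.
  have : 2 * r * (k0 - k1) * t = 0.
    have -> : 2 * r * (k0 - k1) * t =
      2 * (t + r * (- k1 * t)) - 2 * (t + r * (- k0 * t)) by ring.
    by rewrite E subrr.
  move/eqP; rewrite !mulf_eq0 pnatr_eq0 /= (negbTE r0) /= subr_eq0.
  by move=> /orP[/eqP|/eqP].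
rewrite (dist2_hessian u v hN cE) (derive_par u dq) (derive_par u dn) (derive_par v dq) n0 n1.
move: ('D_par0 q 0) ('D_par1 q 0) q01 q00 q11 => f0 f1 q01 q00 q11.
rewrite !(dotDl, dotDr, dotZl, dotZr, scalerDr) (dotC f1 f0) q01 q00 q11.
ring.
Qed.

End Contact.

(** * Recognition of contact of type A1 *)

Section ContactType.
Context {R : realType}.
Implicit Types (U : set 'rV[R]_2) (p m q n : 'rV[R]_2 -> 'rV[R]_3).

Lemma par0_neq0 : (par0 : 'rV[R]_2) != 0.
Proof. by apply/eqP => /rowP/(_ 0); rewrite !mxE /= => /eqP; rewrite oner_eq0. Qed.

Lemma par1_neq0 : (par1 : 'rV[R]_2) != 0.
Proof. by apply/eqP => /rowP/(_ 1); rewrite !mxE /= => /eqP; rewrite oner_eq0. Qed.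

(** The Hessian of the distance function is diagonal with entries 2 (1 - r
    k_i). If both are nonzero, the Morse lemma gives the normal form; if one
    vanishes, the corresponding coordinate vector contradicts the
    nondegeneracy of the normal form. *)
Lemma contact_A1_iff U q n c r : oriented_patch U q n -> curvature_line_parameters U q n ->
  ~ umbilic q n 0 -> 0 < r -> tangent_sphere c r q 0 -> points_towards c q n 0 ->
  sphere_contact 1 c r q 0 <-> forall l, principal_curvatures q n 0 l -> 1 - r * l != 0.
Proof.
move=> hN hc hu r0 hS hp.
have cE := sphere_centre hN r0 hS hp.
have rn0 : r != 0 by rewrite gt_eqF.
have [k0 [k1 [n0 n1 k01 [q00 q11] ->]]] := principal_pair hN hc hu.
have hess u v := dist2_hessian_principal u v hN cE rn0 n0 n1 k01 q00 q11.
have [Uo U0 _ _ hU] := hN.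
have [dq dn] := patch_differentiable hN U0.
have f0 : dist2 c r q 0 = 0 by have [E _] := hS; rewrite /dist2 E subrr.
split.
- move=> [_ hA] l [->|->].
  + apply/eqP => l0; move: par0_neq0 => /eqP; apply.
    apply: (@A1_hessian_inj _ (dist2 c r q)) => // w.
    by rewrite hess l0 !mxE /=; ring.
  + apply/eqP => l0; move: par1_neq0 => /eqP; apply.
    apply: (@A1_hessian_inj _ (dist2 c r q)) => // w.
    by rewrite hess l0 !mxE /=; ring.
- move=> hl.
  have r0k : 1 - r * k0 != 0 by apply: hl; left.
  have r1k : 1 - r * k1 != 0 by apply: hl; right.
  have h00 := hess par0 par0; have h01 := hess par0 par1; have h11 := hess par1 par1.
  rewrite !mxE /= in h00 h01 h11.
  split; first exact: f0.
  apply: (morse_plane Uo U0 (smooth_dist2 c r hN) _ h00 h01 h11).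
  + move=> w; rewrite derive_dist2 // cE opprD addrA subrr add0r -scaleNr dotZl.
    by have [_ _ ->] := hU 0 U0; rewrite !mulr0.
  + by rewrite !(mulr1, mulr0, addr0) mulf_neq0.
  + rewrite !(mulr1, mulr0, addr0, add0r) expr0n /=.
    by rewrite !mulf_neq0.
Qed.

(** For l = 0 both sides hold: 1 / 0 = 0 differs from a positive radius. *)
Lemma radius_neq_inv (r l : R) : 0 < r -> (r <> 1 / l) <-> (1 - r * l != 0).
Proof.
move=> r0; have [->|l0] := eqVneq l 0.
  rewrite mulr0 subr0 oner_eq0 invr0 mulr0; split=> // _ E.
  by rewrite E ltxx in r0.
split=> [rl|rl E].
  apply/eqP => /eqP; rewrite subr_eq0 => /eqP E; apply: rl.
  by rewrite E mulfK.
by move: rl; rewrite E div1r mulVf // subrr eqxx.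
Qed.

End ContactType.

(** * Spheres tangent to two patches *)

Section TangentSpheres.
Context {R : realType}.
Implicit Types (U : set 'rV[R]_2) (p m q n : 'rV[R]_2 -> 'rV[R]_3).

Lemma sub_exchange (V : zmodType) (a b c d : V) : a + b = c + d -> c - a = b - d.
Proof. by move=> E; rewrite -[b](addKr a) E -addrA addrK addrC. Qed.

(** If the unit normals agreed, equal centres would force equal points of
    tangency; distinct unit vectors u, v satisfy (u - v) . v < 0, here
    obtained from |u - v|^2 = - 2 (u - v) . v. *)
Lemma normals_differ UM UN p m q n r : oriented_patch UM p m -> oriented_patch UN q n ->
  p 0 + r *: m 0 = q 0 + r *: n 0 -> p 0 <> q 0 ->
  dot (m 0 - n 0) (n 0) != 0 /\ dot (m 0 - n 0) (m 0 - n 0) != 0.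
Proof.
move=> hM hN E pq.
have [_ UM0 _ _ /(_ 0 UM0)[_ mm _]] := hM; have [_ UN0 _ _ /(_ 0 UN0)[_ nn _]] := hN.
have d0 : dot (m 0 - n 0) (m 0 - n 0) != 0.
  apply/eqP => /dot_eq0/eqP; rewrite subr_eq0 => /eqP mn; apply: pq.
  by move: E; rewrite mn => /addIr.
split=> //; apply: contraNneq d0 => d0.
have -> : dot (m 0 - n 0) (m 0 - n 0) = - 2 * dot (m 0 - n 0) (n 0).
  by rewrite !(dotBl, dotBr) mm nn (dotC (n 0)); ring.
by rewrite d0 mulr0.
Qed.

Lemma derive_Gmap (V : normedModType R) p m q n (X Y : V -> 'rV[R]_2) (S : V -> R)
    z w X' Y' S' :
  differentiable X z -> differentiable Y z -> differentiable S z ->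
  'D_w X z = X' -> 'D_w Y z = Y' -> 'D_w S z = S' ->
  differentiable p (X z) -> differentiable m (X z) ->
  differentiable q (Y z) -> differentiable n (Y z) ->
  'D_w (fun z => Gmap p m q n (X z) (Y z) (S z)) z =
  ('D_X' p (X z) + S z *: 'D_X' m (X z)) - ('D_Y' q (Y z) + S z *: 'D_Y' n (Y z))
   + S' *: (m (X z) - n (Y z)).
Proof.
move=> dX dY dS <- <- <- dp dm dq dn.
have dpX := differentiable_comp dX dp; have dmX := differentiable_comp dX dm.
have dqY := differentiable_comp dY dq; have dnY := differentiable_comp dY dn.
have [dSm DSm] := differentiable_scale dS dmX.
have [dSn DSn] := differentiable_scale dS dnY.
have d1 : differentiable (fun z => p (X z) + S z *: m (X z)) z by exact: differentiableD.
have d2 : differentiable (fun z => p (X z) + S z *: m (X z) - q (Y z)) z by exact: differentiableB.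
rewrite (@deriveB _ _ _ (fun z => p (X z) + S z *: m (X z) - q (Y z)) (fun z => S z *: n (Y z)));
  [|exact: diff_derivable..].
rewrite (@deriveB _ _ _ (fun z => p (X z) + S z *: m (X z)) (q \o Y)); [|exact: diff_derivable..].
rewrite (@deriveD _ _ _ (p \o X) (fun z => S z *: m (X z))); [|exact: diff_derivable..].
rewrite DSm DSn (derive_comp_diff w dX dp) (derive_comp_diff w dX dm).
rewrite (derive_comp_diff w dY dq) (derive_comp_diff w dY dn) /=.
move: ('D_('D_w X z) p (X z)) ('D_('D_w X z) m (X z)) ('D_('D_w Y z) q (Y z))
  ('D_('D_w Y z) n (Y z)) ('D_w S z) (m (X z)) (n (Y z)) => a b c d s e f.
rewrite scalerBr !opprD !addrA.
by rewrite [LHS](AC 6%AC (1*3*4*6*2*5)%AC).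
Qed.

Lemma normal_derive_tangent U q n v : oriented_patch U q n ->
  dot ('D_v n 0) (n 0) = 0.
Proof.
move=> hN; have [Uo U0 _ _ hU] := hN; have [_ dn] := patch_differentiable hN U0.
have [_ D] := derive_dot dn dn.
have : 'D_v (fun x => dot (n x) (n x)) 0 = 0.
  rewrite (@near_eq_derive R _ R _ (cst 1)) ?derive_cst //.
  by apply: filterS (open_nbhs_nbhs (conj Uo U0)) => x /hU[].
rewrite D (dotC (n 0)) => E; apply/eqP; rewrite -[_ == 0]orFb.
by move/eqP: E; rewrite -mulr2n -mulr_natl mulf_eq0 pnatr_eq0.
Qed.

(** The derivative of G in (u, v, r) sends (w, s) to - (D_w q + r0 D_w n) + s
    (m - n). Pairing with n isolates s, because (m - n) . n is nonzero, and
    the hypothesis then isolates w; so the implicit function theorem makes (u,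
    v, r) a function of (s, t) when r is near r0. No other radius can occur
    near the base point: G = 0 says q - p = r (m - n), so r is the quotient of
    (q - p) . (m - n) by |m - n|^2, a continuous function with value r0 there.
    *)
Theorem tangent_spheres_graph UM UN p m q n r0 :
  oriented_patch UM p m -> oriented_patch UN q n ->
  p 0 + r0 *: m 0 = q 0 + r0 *: n 0 -> p 0 <> q 0 ->
  (forall v, 'D_v q 0 + r0 *: 'D_v n 0 = 0 -> v = 0) ->
  exists (V W : set 'rV[R]_2) (g : 'rV[R]_2 -> 'rV[R]_2) (rho : 'rV[R]_2 -> R),
    [/\ [/\ open V, V 0 & V `<=` UM], [/\ open W, W 0 & W `<=` UN],
        smooth V g /\ smooth V rho, forall x, V x -> W (g x) &
        forall x y r, V x -> W y -> Gmap p m q n x y r = 0 <-> y = g x /\ r = rho x].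
Proof.
move=> hM hN E0 pq hess.
have [UMo UM0 _ _ _] := hM; have [UNo UN0 _ _ /(_ 0 UN0)[_ nn np]] := hN.
have [mn0 mm0] := normals_differ hM hN E0 pq.
pose PX : 'M[R]_(2 + (2 + 1), 2) := col_mx 1%:M 0.
pose PY : 'M[R]_(2 + (2 + 1), 2) := col_mx 0 (col_mx 1%:M 0).
pose PS : 'M[R]_(2 + (2 + 1), 1) := col_mx 0 (col_mx 0 1%:M).
pose X (z : 'rV[R]_(2 + (2 + 1))) := z *m PX.
pose Y (z : 'rV[R]_(2 + (2 + 1))) := z *m PY.
pose S (z : 'rV[R]_(2 + (2 + 1))) := (z *m PS) 0 0.
have XE x (y : 'rV[R]_2) (s : 'M[R]_1) : X (row_mx x (row_mx y s)) = x.
  by rewrite /X mul_row_col mulmx1 mulmx0 addr0.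
have YE (x : 'rV[R]_2) (y : 'rV[R]_2) (s : 'M[R]_1) : Y (row_mx x (row_mx y s)) = y.
  by rewrite /Y !mul_row_col mulmx1 !mulmx0 add0r addr0.
have SE (x : 'rV[R]_2) (y : 'rV[R]_2) (s : 'M[R]_1) : S (row_mx x (row_mx y s)) = s 0 0.
  by rewrite /S !mul_row_col mulmx1 !mulmx0 !add0r.
pose F z := Gmap p m q n (X z) (Y z) (S z).
pose U5 := X @^-1` UM `&` Y @^-1` UN.
have linN (N : 'M[R]_(2 + (2 + 1), 2)) (z : 'rV[R]_(2 + (2 + 1))) :
    differentiable (fun z => z *m N) z /\
    forall w, 'D_w (fun z => z *m N) z = w *m N.
  have did : differentiable (id : 'rV[R]_(2 + (2 + 1)) -> 'rV[R]_(2 + (2 + 1))) z by [].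
  by have [d D] := derive_mulmxr N did; split=> // w; rewrite D derive_id.
have dS (z : 'rV[R]_(2 + (2 + 1))) : differentiable S z /\ forall w, 'D_w S z = S w.
  have did : differentiable (id : 'rV[R]_(2 + (2 + 1)) -> 'rV[R]_(2 + (2 + 1))) z by [].
  have [d D] := derive_mulmxr PS did; have [d' D'] := derive_entry 0 d.
  by split=> // w; rewrite D' D derive_id.
have U5o : open U5.
  apply: openI.
    have -> : X @^-1` UM = setT `&` X @^-1` UM by rewrite setTI.
    apply: (@open_preimage_within _ _ setT UM X openT UMo) => z _.
    exact: mulmxr_continuous.
  have -> : Y @^-1` UN = setT `&` Y @^-1` UN by rewrite setTI.
  apply: (@open_preimage_within _ _ setT UN Y openT UNo) => z _.
  exact: mulmxr_continuous.
have nN k (N : 'M[R]_(2 + (2 + 1), 2)) : ndiff k U5 (fun z => z *m N).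
  by apply: ndiff_mulmxr => //; exact: ndiff_id.
have nS k : ndiff k U5 S.
  by apply: ndiff_coord => //; apply: ndiff_mulmxr => //; exact: ndiff_id.
have nF k : ndiff k U5 F.
  have [np' nm'] := patch_ndiff k hM; have [nq' nn'] := patch_ndiff k hN.
  have npX : ndiff k U5 (p \o X) by
    exact: (@ndiff_comp _ _ _ _ _ U5 UM X p U5o (fun z h => proj1 h) (nN k PX) np').
  have nmX : ndiff k U5 (m \o X) by
    exact: (@ndiff_comp _ _ _ _ _ U5 UM X m U5o (fun z h => proj1 h) (nN k PX) nm').
  have nqY : ndiff k U5 (q \o Y) by
    exact: (@ndiff_comp _ _ _ _ _ U5 UN Y q U5o (fun z h => proj2 h) (nN k PY) nq').
  have nnY : ndiff k U5 (n \o Y) by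
    exact: (@ndiff_comp _ _ _ _ _ U5 UN Y n U5o (fun z h => proj2 h) (nN k PY) nn').
  apply: (@ndiffB _ _ _ _ _ (fun z => p (X z) + S z *: m (X z) - q (Y z))
    (fun z => S z *: n (Y z))) => //; last exact: ndiffZ.
  apply: (@ndiffB _ _ _ _ _ (fun z => p (X z) + S z *: m (X z)) (q \o Y)) => //.
  by apply: (@ndiffD _ _ _ _ _ (p \o X) (fun z => S z *: m (X z))) => //; exact: ndiffZ.
pose y3 : 'rV[R]_(2 + 1) := row_mx 0 r0%:M.
pose z0 : 'rV[R]_(2 + (2 + 1)) := row_mx 0 y3.
have X0 : X z0 = 0 by rewrite XE.
have Y0 : Y z0 = 0 by rewrite YE.
have S0 : S z0 = r0 by rewrite SE mxE eqxx mulr1n.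
have Uz0 : U5 z0 by rewrite /U5 /= X0 Y0.
have [dp dm] := patch_differentiable hM UM0; have [dq dn] := patch_differentiable hN UN0.
have F0 : F z0 = 0.
  by rewrite /F /Gmap X0 Y0 S0 E0 -addrA -opprD subrr.
have sF : smooth U5 F by apply/smoothP.
have Finj (w : 'rV[R]_(2 + 1)) : 'D_(row_mx 0 w) F z0 = 0 -> w = 0.
  rewrite -[w]hsubmxK; set v := lsubmx w; set s := rsubmx w.
  have [dX DX] := linN PX z0; have [dY DY] := linN PY z0; have [dSz DS] := dS z0.
  have -> := @derive_Gmap _ p m q n X Y S z0 (row_mx 0 (row_mx v s)) 0 v (s 0 0)
    dX dY dSz _ _ _ _ _ _ _.
  - rewrite X0 Y0 S0 !derive0 scaler0 addr0 sub0r => E.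
    have := congr1 (fun a => dot a (n 0)) E.
    rewrite dot0l dotDl dotNl dotDl !dotZl (normal_derive_tangent v hN) dotC np.
    rewrite mulr0 addr0 oppr0 add0r => /eqP; rewrite mulf_eq0 (negbTE mn0) orbF => /eqP s0.
    move: E; rewrite s0 scale0r addr0 => /eqP; rewrite oppr_eq0 => /eqP/hess v0.
    by rewrite v0 [s]mx11_scalar s0 raddf0 row_mx0.
  - by rewrite DX; exact: XE.
  - by rewrite DY; exact: YE.
  - by rewrite DS; exact: SE.
  - by rewrite X0.
  - by rewrite X0.
  - by rewrite Y0.
  - by rewrite Y0.
have [V3 [W3 [g3 [[V3o V30] [W3o W30] sg3 gW3 P3]]]] := implicit_function U5o Uz0 sF F0 Finj.
have FE x y r : F (row_mx x (row_mx y r%:M)) = Gmap p m q n x y r.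
  by rewrite /F XE YE SE mxE eqxx mulr1n.
have /nbhs_ballP[e /= e0 eW] : nbhs y3 W3 by exact: open_nbhs_nbhs.
have inW3 (y : 'rV[R]_2) r : `|y| < e -> `|r - r0| < e -> W3 (row_mx y r%:M).
  move=> ye re; apply: eW; rewrite mx_norm_ball /ball_ /= distrC /y3 opp_row_mx add_row_mx subr0.
  apply: row_mx_norm_lt => //; rewrite -raddfB /=; apply: le_lt_trans re.
  by apply: mx_norm_le => // i j; rewrite mxE !ord1 eqxx mulr1n.
pose X4 (z : 'rV[R]_(2 + 2)) : 'rV[R]_2 := lsubmx z.
pose Y4 (z : 'rV[R]_(2 + 2)) : 'rV[R]_2 := rsubmx z.
pose num z := dot (q (Y4 z) - p (X4 z)) (m (X4 z) - n (Y4 z)).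
pose den z := dot (m (X4 z) - n (Y4 z)) (m (X4 z) - n (Y4 z)).
have X40 : X4 0 = 0 by rewrite /X4 raddf0.
have Y40 : Y4 0 = 0 by rewrite /Y4 raddf0.
have dX4 : differentiable X4 0 by exact: differentiable_lsubmx.
have dY4 : differentiable Y4 0 by exact: differentiable_rsubmx.
have dpX : differentiable (p \o X4) 0 by apply: (differentiable_comp dX4); rewrite X40.
have dmX : differentiable (m \o X4) 0 by apply: (differentiable_comp dX4); rewrite X40.
have dqY : differentiable (q \o Y4) 0 by apply: (differentiable_comp dY4); rewrite Y40.
have dnY : differentiable (n \o Y4) 0 by apply: (differentiable_comp dY4); rewrite Y40.
have dqp : differentiable (fun z => q (Y4 z) - p (X4 z)) 0 by exact: (differentiableB dqY dpX).
have dmn : differentiable (fun z => m (X4 z) - n (Y4 z)) 0 by exact: (differentiableB dmX dnY).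
have dnum : differentiable num 0 by have [] := derive_dot dqp dmn.
have dden : differentiable den 0 by have [] := derive_dot dmn dmn.
have den0 : den 0 != 0 by rewrite /den X40 Y40.
(* the only radius possible for the pair of points encoded by z *)
pose tau z := num z * (den z)^-1.
have dtau : differentiable tau 0.
  by have [] := deriveMf dnum (differentiableV dden den0).
have tau0 : tau 0 = r0.
  rewrite /tau; have -> : num 0 = r0 * den 0.
    rewrite /num /den X40 Y40 -dotZl scalerBr; congr (dot _ _).
    exact: (sub_exchange E0).
  by rewrite mulfK.
have nden : \forall z \near (0 : 'rV[R]_(2 + 2)), den z != 0.
  exact: (cvgr_neq0 _ (differentiable_continuous dden) den0).
have ntau : \forall z \near (0 : 'rV[R]_(2 + 2)), `|tau z - r0| < e.
  have /cvgr_dist_lt/(_ _ e0) := differentiable_continuous dtau.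
  by rewrite tau0; apply: filterS => z; rewrite distrC.
have [d /= d0 dP] := proj1 (nbhs_ballP _ _) (filterI nden ntau).
have radius (x y : 'rV[R]_2) r : `|x| < d -> `|y| < d -> Gmap p m q n x y r = 0 -> `|r - r0| < e.
  move=> xd yd G0.
  have [] : den (row_mx x y) != 0 /\ `|tau (row_mx x y) - r0| < e.
    by apply: dP; rewrite mx_norm_ball /ball_ /= sub0r normrN; exact: row_mx_norm_lt.
  rewrite /tau /num /den /X4 /Y4 row_mxKl row_mxKr => nz.
  have -> : q y - p x = r *: (m x - n y).
    rewrite scalerBr; apply: sub_exchange; apply/eqP; rewrite -subr_eq0 opprD addrA.
    exact/eqP.
  by rewrite dotZl mulfK.
pose W := [set y : 'rV[R]_2 | `|y| < Num.min e d].
have Wo : open W by exact: open_oball.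
have ed0 : 0 < Num.min e d by rewrite lt_min e0.
pose g x : 'rV[R]_2 := g3 x *m col_mx 1%:M 0.
pose rho x : R := (g3 x *m col_mx 0 1%:M) 0 0.
have gE x : g3 x = row_mx (g x) (rho x)%:M.
  rewrite -[LHS]hsubmxK /g /rho mulmx_col_projl mulmx_col_projr; congr row_mx.
  exact: mx11_scalar.
have g30 : g3 0 = y3.
  by apply/esym; have [_ <-] := P3 0 y3 V30 W30.
have g0 : g 0 = 0 by rewrite /g g30 mulmx_col_projl row_mxKl.
pose V := [set x : 'rV[R]_2 | `|x| < d] `&` (V3 `&` g @^-1` W).
have ng3 k : ndiff k V3 g3 by exact: (proj1 (smoothP _ _) sg3).
have ng k : ndiff k V3 g by exact: ndiff_mulmxr.
have VV3 : V `<=` V3 by move=> x [_ []].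
have Vo : open V.
  apply: openI; first exact: open_oball.
  apply: (@open_preimage_within _ _ V3 W g V3o Wo) => x Vx.
  apply: differentiable_continuous; exact: ndiff_differentiable (ng 0%N) Vx.
have re0 : `|r0 - r0| < e by rewrite subrr normr0.
have We y : W y -> `|y| < e by rewrite /W /= lt_min => /andP[].
have Wd y : W y -> `|y| < d by rewrite /W /= lt_min => /andP[].
have W0 : W 0 by rewrite /W /= normr0.
exists V, W, g, rho; split.
- split=> //; first by split; [rewrite /= normr0|split=> //; rewrite /= g0].
  move=> x /VV3 Vx; have [[Ux _] _] := P3 x _ Vx W30.
  by rewrite /= XE in Ux.
- split=> // y Wy; have [[_ Uy] _] := P3 0 _ V30 (inW3 y r0 (We y Wy) re0).
  by rewrite /= YE in Uy.
- split; apply/smoothP => k; first exact: ndiff_subset VV3 (ng k).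
  apply: ndiff_subset VV3 _; apply: ndiff_coord => //; exact: ndiff_mulmxr.
- by move=> x [_ []].
- move=> x y r Vx Wy; have [xd [V3x Wgx]] := Vx; split.
    move=> G0; have re := radius x y r xd (Wd y Wy) G0.
    have [_ [+ _]] := P3 x _ V3x (inW3 y r (We y Wy) re).
    rewrite FE => /(_ G0); rewrite gE => /eq_row_mx[-> rr]; split=> //.
    by have := congr1 (fun M : 'M[R]_1 => M 0 0) rr; rewrite !mxE eqxx !mulr1n.
  move=> [-> ->]; rewrite -FE -gE.
  by have [_ [_ ]] := P3 x _ V3x (gW3 x V3x); apply.
Qed.

End TangentSpheres.

(** In the principal directions the parallel surface q + r n has derivatives
    (1 - r k_i) f_i. *)
Lemma parallel_surface_regular (R : realType) (U : set 'rV[R]_2)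
    (q n : 'rV[R]_2 -> 'rV[R]_3) (r : R) :
  oriented_patch U q n -> curvature_line_parameters U q n -> ~ umbilic q n 0 ->
  (forall l, principal_curvatures q n 0 l -> 1 - r * l != 0) ->
  forall v, 'D_v q 0 + r *: 'D_v n 0 = 0 -> v = 0.
Proof.
move=> hN hc hu hl v; have [_ U0 _ _ _] := hN.
have [dq dn] := patch_differentiable hN U0.
have [k0 [k1 [n0 n1 _ _ PC]]] := principal_pair hN hc hu.
have r0k : 1 - r * k0 != 0 by apply: hl; rewrite PC; left.
have r1k : 1 - r * k1 != 0 by apply: hl; rewrite PC; right.
rewrite (derive_par v dq) (derive_par v dn) n0 n1 => E.
have : (v 0 0 * (1 - r * k0)) *: 'D_par0 q 0 + (v 0 1 * (1 - r * k1)) *: 'D_par1 q 0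
    + 0 *: n 0 = 0.
  move: E; move: ('D_par0 q 0) ('D_par1 q 0) => f0 f1 E.
  rewrite scale0r addr0 -[RHS]E scalerDr !scalerA addrACA -!scalerDl.
  by congr (_ *: _ + _ *: _); ring.
move=> /(patch_free hN)[/eqP + /eqP + _].
rewrite !mulf_eq0 (negbTE r0k) (negbTE r1k) !orbF => /eqP v0 /eqP v1.
by rewrite (par_decomp v) v0 v1 !scale0r addr0.
Qed.

Unset Implicit Arguments.
Set Strict Implicit.
Set Printing Implicit Defensive.

Theorem proposition2 (R : realType)
  (UM UN : set 'rV[R]_2) (p m q n : 'rV[R]_2 -> 'rV[R]_3)
  (c : 'rV[R]_3) (r0 l1 l2 : R)
  (hM : oriented_patch UM p m) (hN : oriented_patch UN q n)
  (hpM : curvature_line_parameters UM p m)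
  (hpN : curvature_line_parameters UN q n)
  (hr0 : 0 < r0)
  (hSM : tangent_sphere c r0 p 0) (hSN : tangent_sphere c r0 q 0)
  (hpq : p 0 <> q 0)
  (hmc : points_towards c p m 0) (hnc : points_towards c q n 0)
  (huM : ~ umbilic p m 0) (huN : ~ umbilic q n 0)
  (hl : principal_curvatures q n 0 = [set l1; l2]) :
  (sphere_contact 1 c r0 q 0 <-> (r0 <> 1 / l1 /\ r0 <> 1 / l2)) /\
  (sphere_contact 1 c r0 q 0 ->
   exists (V W : set 'rV[R]_2) (I : set R)
     (g : 'rV[R]_2 -> 'rV[R]_2) (rho : 'rV[R]_2 -> R),
     [/\ [/\ open V, V 0 & V `<=` UM],
         [/\ open W, W 0 & W `<=` UN],
         open I /\ I r0,
         smooth V g /\ smooth V rho &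
         [/\ [set z : 'rV[R]_2 * 'rV[R]_2 * R |
                [/\ V z.1.1, W z.1.2, I z.2 &
                    Gmap p m q n z.1.1 z.1.2 z.2 = 0]]
               = [set (x, g x, rho x) | x in V],
             presymmetry_set I p m q n `&` (V `*` W)
               = [set (x, g x) | x in V] &
             presymmetry_set setT p m q n `&` (V `*` W)
               = [set (x, g x) | x in V]]]).
Proof.
have A1P := contact_A1_iff hN hpN huN hr0 hSN hnc.
split.
  split=> [/A1P rl|[r1 r2]].
    split; apply/(radius_neq_inv _ hr0); apply: rl; rewrite hl; [by left|by right].
  by apply/A1P => l; rewrite hl => -[->|->]; apply/(radius_neq_inv _ hr0).
move=> /A1P rl.
have E0 : p 0 + r0 *: m 0 = q 0 + r0 *: n 0.
  by rewrite -(sphere_centre hM hr0 hSM hmc) -(sphere_centre hN hr0 hSN hnc).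
have [V [W [g [rho [Vp Wp sgr gW G]]]]] := tangent_spheres_graph hM hN E0 hpq
  (parallel_surface_regular hN hpN huN rl).
have presym : presymmetry_set setT p m q n `&` (V `*` W) = [set (x, g x) | x in V].
  apply/seteqP; split=> [[x y] /= [[r _ Gr] [Vx Wy]]|_ [x Vx <-] /=].
    by have [/(_ Gr)[-> _] _] := G x y r Vx Wy; exists x.
  have Wgx := gW x Vx; split=> //.
  by exists (rho x) => //; apply/(G x (g x) (rho x) Vx Wgx).
(* V and W are so small that no radius needs to be excluded *)
exists V, W, setT, g, rho; split=> //.
  by split=> //; exact: openT.
split=> //.
apply/seteqP; split=> [[[x y] r] /= [Vx Wy _ Gr]|_ [x Vx <-] /=].
  by have [/(_ Gr)[-> ->] _] := G x y r Vx Wy; exists x.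
have Wgx := gW x Vx; split=> //.
by apply/(G x (g x) (rho x) Vx Wgx).
Qed.
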